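(* Let $P$ be a set of (non-empty) permutations such that every element of $\overline{P}$ is sum-indecomposable, and let $n\ge0$. Then the staircase encoding $\mathrm{SE}$ is a bijection between $\mathrm{Av}^{(n)}(2413,3142,3124,1\oplus P)$ and $\mathrm{WI}_{\rho}(\mathcal{UDC}(B_n),\mathrm{Av}^{+}(312,\overline{P}),\mathrm{Av}^{+}(2413,3142,3124,P))$.
   Context: A permutation of size $n$ is a word containing each of $1,\dots,n$ exactly once. $\sigma$ contains $\pi$ if some subsequence of $\sigma$ has the same relative order as $\pi$; otherwise it avoids $\pi$. $\mathrm{Av}(P)$ is the set of permutations avoiding every element of $P$, $\mathrm{Av}^{+}(P)$ its non-empty elements. For $\alpha$ of size $a$, $\beta$ of size $b$: $\alpha\oplus\beta=\alpha_1\cdots\alpha_a(\beta_1+a)\cdots(\beta_b+a)$; a permutation is sum-indecomposable if it is not $\alpha\oplus\beta$ with $\alpha,\beta$ non-empty. $1\oplus P=\{1\oplus\pi:\pi\in P\}$. The empty permutation is not in $P$. For a permutation $\sigma$, $\overline{\sigma}=\alpha$ if $\sigma=\alpha\oplus1$ for some permutation $\alpha$ (i.e. $\sigma$ ends with its maximum, which is removed), and $\overline{\sigma}=\sigma$ otherwise; $\overline{P}=\{\overline{\pi}:\pi\in P\}$. A left-to-right minimum of $\sigma$ is an entry $\sigma_i$ with $\sigma_j>\sigma_i$ for all $j<i$; $\mathrm{Av}^{(n)}(Q)$ is the set of permutations in $\mathrm{Av}(Q)$ with exactly $n$ left-to-right minima. $B_n=\{(i,j):1\le i\le j\le n\}$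 (row $i$, column $j$, row 1 on top). If $\sigma$ has left-to-right minima at positions $p_1<\dots<p_n$ with values $v_1>\dots>v_n$, each non-minimum entry $\sigma_k$ lies in cell $(i,j)$ where $j$ is the largest index with $p_j<k$ and $i$ the smallest index with $v_i<\sigma_k$. $\mathrm{SE}(\sigma)$ is the filling of $B_n$ putting in each cell the standardization of the entries of $\sigma$ in that cell (empty permutation if none). $\mathcal{UDC}(B_n)$ is the graph on $B_n$ in which distinct $(i,j),(k,\ell)$ are adjacent iff at least one of: $i>k$ and $j<\ell$ (or symmetrically); $i<k$, $j<\ell$ and $\{i,\dots,k\}\times\{j,\dots,\ell\}\subseteq B_n$ (or symmetrically); $j=\ell$. For an independent set $I$ and $v\in I$, $\rho(v,I)=y$ if $v$ is not the rightmost cell of $I$ in its row, and $\rho(v,I)=z$ otherwise. $\mathrm{WI}_\rho(G,Y,Z)$ is the set of fillings of $B_n$ whose set $I$ of non-empty cells is an independent set of $G$, where each $v\in I$ contains an element of $Y$ if $\rho(v,I)=y$ and of $Z$ if $\rho(v,I)=z$. ''SE is a bijection between $X$ and $W$'' means SE restricted to $X$ is injective with image exactly $W$. *)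

(* Defs.v *)
From mathcomp Require Import all_boot.
From mathcomp Require Import boolp classical_sets functions.

Set Implicit Arguments.
Unset Strict Implicit.
Unset Printing Implicit Defensive.

Local Open Scope classical_set_scope.

(* Permutations are words over nat with values 1, ..., size s; positions in a
   word are counted from 0. *)
Definition is_perm (s : seq nat) : bool := perm_eq s (iota 1 (size s)).

Definition order_iso (s t : seq nat) : Prop :=
  size s = size t /\
  forall i j, i < size s -> j < size s ->
    (nth 0 s i < nth 0 s j) = (nth 0 t i < nth 0 t j).

Definition contains (s p : seq nat) : Prop :=
  exists2 t, subseq t s & order_iso t p.

Definition Av (Q : set (seq nat)) : set (seq nat) :=
  [set s | is_perm s /\ forall p, Q p -> ~ contains s p].

Definition Avp (Q : set (seq nat)) : set (seq nat) :=
  [set s | Av Q s /\ s <> [::]].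

Definition oplus (a b : seq nat) : seq nat := a ++ [seq x + size a | x <- b].

(* With this definition the empty permutation is sum-indecomposable; it is the
   image of the one-point permutation under bar below. *)
Definition sum_indecomposable (s : seq nat) : Prop :=
  ~ exists a b, [/\ is_perm a, is_perm b, a <> [::], b <> [::] & s = oplus a b].

(* If s = oplus a [:: 1], then a is necessarily s without its last entry. *)
Definition bar (s : seq nat) : seq nat :=
  let a := take (size s).-1 s in
  if is_perm a && (s == oplus a [:: 1]) then a else s.

Definition is_lrmin (s : seq nat) (k : nat) : bool :=
  all (fun j => nth 0 s k < nth 0 s j) (iota 0 k).

Definition lrmin_pos (s : seq nat) : seq nat :=
  [seq k <- iota 0 (size s) | is_lrmin s k].

Definition lrmin_val (s : seq nat) : seq nat :=
  [seq nth 0 s k | k <- lrmin_pos s].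

Definition Avn (n : nat) (Q : set (seq nat)) : set (seq nat) :=
  [set s | Av Q s /\ size (lrmin_pos s) = n].

(* Rows and columns of B_n are indexed from 0: the pair (i, j) stands for the
   cell (i + 1, j + 1) of the staircase grid. *)
Definition inB (n : nat) (c : 'I_n * 'I_n) : bool := c.1 <= c.2.

Definition cell (n : nat) := {c : 'I_n * 'I_n | inB c}.

Definition crow (n : nat) (c : cell n) : 'I_n := (val c).1.
Definition ccol (n : nat) (c : cell n) : 'I_n := (val c).2.

Definition filling (n : nat) := {ffun cell n -> seq nat}.

(* For a position k that is not a left-to-right minimum, both index sets below
   are non-empty. *)
Definition entry_col (s : seq nat) (k : nat) : nat :=
  \max_(j < size (lrmin_pos s) | nth 0 (lrmin_pos s) j < k) j.

Definition entry_row (s : seq nat) (k : nat) : nat :=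
  find (fun v => v < nth 0 s k) (lrmin_val s).

Definition cell_entries (s : seq nat) (i j : nat) : seq nat :=
  [seq nth 0 s k | k <- iota 0 (size s)
    & [&& ~~ is_lrmin s k, entry_row s k == i & entry_col s k == j]].

Definition standardize (s : seq nat) : seq nat :=
  [seq (count (fun y => y < x) s).+1 | x <- s].

(* Meaningful for permutations s with exactly n left-to-right minima. *)
Definition SE (n : nat) (s : seq nat) : filling n :=
  [ffun c : cell n => standardize (cell_entries s (crow c) (ccol c))].

Definition rect_inB (n : nat) (i k j l : 'I_n) : bool :=
  [forall a : 'I_n, forall b : 'I_n,
    (i <= a <= k) && (j <= b <= l) ==> inB (a, b)].

Definition up_adj (n : nat) (c d : cell n) : bool :=
  (crow d < crow c) && (ccol c < ccol d).

Definition down_adj (n : nat) (c d : cell n) : bool :=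
  [&& crow c < crow d, ccol c < ccol d &
      rect_inB (crow c) (crow d) (ccol c) (ccol d)].

Definition UDC (n : nat) : rel (cell n) :=
  fun c d => (c != d) &&
    [|| up_adj c d, up_adj d c, down_adj c d, down_adj d c
      | ccol c == ccol d].

Definition independent (T : finType) (e : rel T) (I : {set T}) : Prop :=
  forall u v, u \in I -> v \in I -> ~~ e u v.

Inductive label := LabelY | LabelZ.

Definition rho (n : nat) (v : cell n) (I : {set cell n}) : label :=
  if [exists u in I, (crow u == crow v) && (ccol v < ccol u)]
  then LabelY else LabelZ.

Definition nonempty_cells (n : nat) (w : filling n) : {set cell n} :=
  [set c | w c != [::]]%SET.

Definition WI (n : nat) (r : cell n -> {set cell n} -> label) (G : rel (cell n))
    (Y Z : set (seq nat)) : set (filling n) :=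
  [set w | independent G (nonempty_cells w) /\
    forall v, v \in nonempty_cells w ->
      match r v (nonempty_cells w) with
      | LabelY => Y (w v)
      | LabelZ => Z (w v)
      end].

(* Main.v *)
Require Import Defs.
From mathcomp Require Import all_boot.
From mathcomp Require Import zify.
From mathcomp Require Import boolp classical_sets functions.

(** Cut a permutation along its left-to-right minima. Two entries whose cells are
    adjacent in the graph form, together with suitable minima, one of 2413, 3142,
    3124; hence in an avoider each column meets at most one non-empty cell and,
    again by 2413, the cells of a row increase from left to right. Both the
    position order and the value order of all entries can then be read off the
    filling, so the filling determines the permutation, and any filling with one
    non-empty cell per column and permutation contents is realised by sorting
    labels. Conversely, in a permutation built this way the entries above and to
    the right of a given minimum all lie in one row, that is, in a direct sum of
    cell contents; so an indecomposable pattern there sits in a single cell, and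
    only a final maximum of a pattern may sit in a later cell of the row. *)

Set Implicit Arguments.
Unset Strict Implicit.
Unset Printing Implicit Defensive.

Local Open Scope classical_set_scope.

(** * Standardization and pattern embeddings *)

Lemma size_standardize t : size (standardize t) = size t.
Proof. exact: size_map. Qed.

(** When [x < y], the entry [x] itself is counted below [y] but not below [x], which makes the
    inequality strict. *)
Lemma count_ltn_mono t x y :
  x \in t -> (count (fun z => z < x) t < count (fun z => z < y) t) = (x < y).
Proof.
move=> xt; have [ltxy|leyx] := ltnP x y; last first.
  by rewrite ltnNge; apply/negbF/sub_count => z /= zy; apply: leq_trans zy leyx.
have: 0 < count_mem x t by rewrite -has_count has_pred1.
suff: count (fun z => z < x) t + count_mem x t <= count (fun z => z < y) t by lia.
by elim: t {xt} => //= z t IH; lia.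
Qed.

Lemma standardize_lt t i j : i < size t -> j < size t ->
  (nth 0 (standardize t) i < nth 0 (standardize t) j) = (nth 0 t i < nth 0 t j).
Proof.
move=> ti tj; rewrite !(nth_map 0) // ltnS; exact/count_ltn_mono/mem_nth.
Qed.

Lemma standardize_bounds t x : x \in standardize t -> 0 < x <= size t.
Proof.
move=> /mapP[y yt ->] /=; rewrite -(count_predC (fun z => z < y)).
suff: 0 < count (predC (fun z => z < y)) t by lia.
by rewrite -has_count; apply/hasP; exists y => //=; rewrite ltnn.
Qed.

Lemma is_perm_subset t : uniq t -> (forall x, x \in t -> 0 < x <= size t) -> is_perm t.
Proof.
move=> ut tb; apply: uniq_perm; rewrite ?iota_uniq //.
apply: (uniq_min_size ut _ _).2; last by rewrite size_iota.
by move=> x /tb; rewrite mem_iota add1n.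
Qed.

Lemma is_perm_standardize t : uniq t -> is_perm (standardize t).
Proof.
move=> ut; have us : uniq (standardize t).
  rewrite map_inj_in_uniq // => x y xt yt [] exy.
  apply/eqP; rewrite eqn_leq leqNgt -(count_ltn_mono _ yt) exy ltnn /=.
  by rewrite leqNgt -(count_ltn_mono _ xt) exy ltnn.
apply: is_perm_subset => // x /standardize_bounds; by rewrite size_standardize.
Qed.

Lemma is_perm_uniq s : is_perm s -> uniq s.
Proof. by move/perm_uniq->; apply: iota_uniq. Qed.

Lemma is_perm_mem s x : is_perm s -> (x \in s) = (0 < x <= size s).
Proof. by move/perm_mem->; rewrite mem_iota add1n. Qed.

Lemma count_ltn_iota n m : count (fun z => z < m) (iota 1 n) = minn n m.-1.
Proof.
elim: n => [|n IH]; first by rewrite min0n.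
by rewrite -[n.+1]addn1 iotaD count_cat IH /= addn0; lia.
Qed.

Lemma standardize_id s : is_perm s -> standardize s = s.
Proof.
move=> ps; rewrite -[RHS]map_id; apply/eq_in_map => x; rewrite is_perm_mem // => xs.
by rewrite (permP ps) count_ltn_iota; lia.
Qed.

Lemma order_iso_standardize s t : order_iso s t -> standardize s = standardize t.
Proof.
move=> [est st]; apply: (@eq_from_nth _ 0); rewrite !size_standardize // => i si.
rewrite !(nth_map 0) -?est //; congr _.+1.
have cE u x : count (fun z => z < x) u
    = count (fun j => nth 0 u j < x) (iota 0 (size u)).
  by rewrite -[in LHS](mkseq_nth 0 u) count_map.
rewrite !cE -est.
by apply: eq_in_count => j; rewrite mem_iota => /= sj; apply: st.
Qed.

Lemma order_iso_perm_eq s t : is_perm s -> is_perm t -> order_iso s t -> s = t.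
Proof. by move=> ps pt /order_iso_standardize; rewrite !standardize_id. Qed.

Lemma nth_ltn_sorted ks a b : sorted ltn ks -> a < b < size ks ->
  nth 0 ks a < nth 0 ks b.
Proof.
move=> sk /andP[ab bk].
by apply: (sorted_ltn_nth ltn_trans 0 sk) => //; rewrite inE // (ltn_trans ab).
Qed.

Lemma nth_ltn_sortedE ks a b : sorted ltn ks -> a < size ks -> b < size ks ->
  (nth 0 ks a < nth 0 ks b) = (a < b).
Proof.
move=> sk ka kb; case: (ltngtP a b) => [ab|ba|->]; last by rewrite ltnn.
  by rewrite nth_ltn_sorted ?ab.
by apply/negbTE; rewrite -leqNgt ltnW // nth_ltn_sorted ?ba.
Qed.

Lemma index_ltn_sorted ks k l : sorted ltn ks -> k \in ks -> l \in ks ->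
  (index k ks < index l ks) = (k < l).
Proof.
by move=> sk kk lk; rewrite -(nth_ltn_sortedE sk) ?index_mem // !nth_index.
Qed.

Lemma sorted_subseq_iota ks m : sorted ltn ks -> all (fun k => k < m) ks ->
  subseq ks (iota 0 m).
Proof.
move=> sk /allP km; suff -> : ks = [seq k <- iota 0 m | k \in ks] by exact: filter_subseq.
apply: (irr_sorted_eq ltn_trans ltnn sk).
  by apply: sorted_filter; [exact: ltn_trans|exact: iota_ltn_sorted].
move=> k; rewrite mem_filter mem_iota /= add0n.
by case: (boolP (k \in ks)) => //= /km ->.
Qed.

(** Containment by positions: [f i] is the position in [s] of the [i]-th letter of [p]. Nothing is
    asked of [f] from [size p] on, so one [f] can serve both a pattern and its prefixes. *)
Definition embeds (s p : seq nat) (f : nat -> nat) : Prop :=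
  [/\ forall i j, i < j < size p -> f i < f j,
      forall i, i < size p -> f i < size s &
      forall i j, i < size p -> j < size p ->
        (nth 0 s (f i) < nth 0 s (f j)) = (nth 0 p i < nth 0 p j)].

Lemma containsP s p : contains s p <-> exists f, embeds s p f.
Proof.
split=> [[t /subseqP[m _ ->] [sz iso]]|[f [f_mono f_lt f_ord]]].
  (* The mask that selects the subsequence, applied to the list of positions, enumerates the
     occurrence. *)
  set ks := mask m (iota 0 (size s)).
  have et : mask m s = [seq nth 0 s k | k <- ks].
    by rewrite map_mask map_nth_iota0 // take_size.
  have sk : sorted ltn ks.
    by apply: sorted_mask; [exact: ltn_trans|exact: iota_ltn_sorted].
  have szk : size ks = size p by rewrite -sz et size_map.
  exists (nth 0 ks); split=> [i j|i ip|i j ip jp].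
  - by rewrite -szk; apply: nth_ltn_sorted.
  - have : nth 0 ks i \in ks by rewrite mem_nth ?szk.
    by move/mem_mask; rewrite mem_iota.
  - by rewrite -iso ?et ?size_map ?szk // !(nth_map 0) ?szk.
exists [seq nth 0 s k | k <- [seq f i | i <- iota 0 (size p)]].
  rewrite -[X in subseq _ X](mkseq_nth 0 s); apply/map_subseq/sorted_subseq_iota.
    apply: (homo_sorted_in (P := fun i => i < size p) (e := ltn)).
    - by move=> i j _ jp ij; apply: f_mono; apply/andP.
    - by apply/allP => i; rewrite mem_iota.
    - exact: iota_ltn_sorted.
  by apply/allP => k /mapP[i]; rewrite mem_iota => /= ip ->; apply: f_lt.
split; rewrite !size_map size_iota // => i j ip jp.
by rewrite !(nth_map 0) ?size_map ?size_iota // !nth_iota // !add0n f_ord.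
Qed.

(** * Left-to-right minima and cells *)

Lemma is_lrminP s k :
  reflect (forall j, j < k -> nth 0 s k < nth 0 s j) (is_lrmin s k).
Proof.
apply: (iffP allP) => h j; last by rewrite mem_iota add0n => /h.
by move=> jk; apply: h; rewrite mem_iota.
Qed.

Definition nonmin s k := (k < size s) && ~~ is_lrmin s k.

Lemma mem_lrmin_pos s k : (k \in lrmin_pos s) = (k < size s) && is_lrmin s k.
Proof. by rewrite mem_filter mem_iota add0n andbC. Qed.

Lemma sorted_lrmin_pos s : sorted ltn (lrmin_pos s).
Proof. by apply: sorted_filter; [exact: ltn_trans|exact: iota_ltn_sorted]. Qed.

Lemma nth_lrmin_val s j : j < size (lrmin_pos s) ->
  nth 0 (lrmin_val s) j = nth 0 s (nth 0 (lrmin_pos s) j).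
Proof. by move=> js; rewrite (nth_map 0). Qed.

Lemma lrmin_pos_ex s k : k < size s -> is_lrmin s k ->
  exists2 j, j < size (lrmin_pos s) & nth 0 (lrmin_pos s) j = k.
Proof.
move=> ks km; have kp : k \in lrmin_pos s by rewrite mem_lrmin_pos ks.
by exists (index k (lrmin_pos s)); rewrite ?index_mem ?nth_index.
Qed.

Lemma nth_lrmin_pos s j : j < size (lrmin_pos s) ->
  nth 0 (lrmin_pos s) j < size s /\ is_lrmin s (nth 0 (lrmin_pos s) j).
Proof. by move=> /(mem_nth 0); rewrite mem_lrmin_pos => /andP. Qed.

Lemma ltn_lrmin_pos s i j : i < size (lrmin_pos s) -> j < size (lrmin_pos s) ->
  (nth 0 (lrmin_pos s) i < nth 0 (lrmin_pos s) j) = (i < j).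
Proof. exact/nth_ltn_sortedE/sorted_lrmin_pos. Qed.

Lemma ltn_lrmin_val s i j : i < size (lrmin_pos s) -> j < size (lrmin_pos s) ->
  (nth 0 (lrmin_val s) i < nth 0 (lrmin_val s) j) = (j < i).
Proof.
move=> ip jp; have [ij|ji|->] := ltngtP j i; last by rewrite ltnn.
  rewrite !nth_lrmin_val //; have [_ /is_lrminP] := nth_lrmin_pos ip.
  by apply; rewrite ltn_lrmin_pos.
apply/negbTE; rewrite -leqNgt ltnW // !nth_lrmin_val //.
have [_ /is_lrminP] := nth_lrmin_pos jp.
by apply; rewrite ltn_lrmin_pos.
Qed.

(** Strong induction on the position: an entry that is not a minimum has an earlier entry that is no
    larger. *)
Lemma lrmin_below s k : exists p, [/\ p <= k, is_lrmin s p & nth 0 s p <= nth 0 s k].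
Proof.
elim/ltn_ind: k => k IH.
have [/allP kmin|/allPn[j]] := boolP (is_lrmin s k); first by exists k; split=> //; exact/allP.
rewrite mem_iota add0n -leqNgt => /= jk sjk; have [p [pj pm ps]] := IH _ jk.
by exists p; split=> //; [exact: leq_trans pj (ltnW jk)|exact: leq_trans ps sjk].
Qed.

Lemma lrmin_lt s k : uniq s -> nonmin s k ->
  exists2 j, j < size (lrmin_pos s) &
    nth 0 (lrmin_pos s) j < k /\ nth 0 (lrmin_val s) j < nth 0 s k.
Proof.
move=> us /andP[ks km]; have [p [pk pm ps]] := lrmin_below s k.
have ltpk : p < k by rewrite ltn_neqAle pk andbT; apply: contraNneq km => <-.
have [j js ej] := lrmin_pos_ex (ltn_trans ltpk ks) pm.
exists j => //; rewrite nth_lrmin_val // ej; split=> //.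
by rewrite ltn_neqAle ps andbT nth_uniq ?(ltn_trans ltpk) // neq_ltn ltpk.
Qed.

(** The values of the minima decrease, so those below an entry form a final segment, which starts at
    the index returned by [find]. *)
Lemma lrmin_val_lt s k j : j < size (lrmin_pos s) ->
  (nth 0 (lrmin_val s) j < nth 0 s k) = (entry_row s k <= j).
Proof.
move=> js; have [rj|jr] := leqP (entry_row s k) j; last exact: (before_find 0 jr).
have hr : has (fun v => v < nth 0 s k) (lrmin_val s).
  by rewrite has_find (leq_ltn_trans rj) // size_map.
have /= hf := nth_find 0 hr; apply: leq_ltn_trans hf.
by rewrite leqNgt ltn_lrmin_val -?leqNgt // (leq_ltn_trans rj).
Qed.

Lemma entry_row_lt s k : uniq s -> nonmin s k -> entry_row s k < size (lrmin_pos s).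
Proof.
move=> us /(lrmin_lt us)[j js [_]]; rewrite lrmin_val_lt // => rj.
exact: leq_ltn_trans rj js.
Qed.

(** The positions of the minima increase, so those before [k] form an initial segment, whose last
    index is the maximum in [entry_col]. *)
Lemma entry_col_spec s k : uniq s -> nonmin s k ->
  entry_col s k < size (lrmin_pos s) /\
  forall j, j < size (lrmin_pos s) -> (nth 0 (lrmin_pos s) j < k) = (j <= entry_col s k).
Proof.
move=> us km; have [j0 j0s [j0k _]] := lrmin_lt us km.
rewrite /entry_col.
(* The maximum is attained because [j0] makes the index set non-empty. *)
have [i ik ei] := eq_bigmax_cond (fun j : 'I_(size (lrmin_pos s)) => j : nat)
  (A := [pred j : 'I_(size (lrmin_pos s)) | nth 0 (lrmin_pos s) j < k])
  (introT card_gt0P (ex_intro _ (Ordinal j0s) j0k)).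
set m := bigop _ _ _; have em : m = i := ei.
have ik' : nth 0 (lrmin_pos s) i < k := ik.
split=> [|j js]; first by rewrite em.
have [jm|mj] := leqP j m.
  apply: leq_ltn_trans ik'; rewrite leqNgt ltn_lrmin_pos // -leqNgt.
  by rewrite -em.
apply: contraTF mj => jk; rewrite -leqNgt.
exact: (@leq_bigmax_cond _ (fun j : 'I_(size (lrmin_pos s)) => nth 0 (lrmin_pos s) j < k)
  (fun j => j : nat) (Ordinal js)).
Qed.

Lemma entry_col_lt s k : uniq s -> nonmin s k -> entry_col s k < size (lrmin_pos s).
Proof. by move=> us km; have [] := entry_col_spec us km. Qed.

Lemma lrmin_pos_lt s k j : uniq s -> nonmin s k -> j < size (lrmin_pos s) ->
  (nth 0 (lrmin_pos s) j < k) = (j <= entry_col s k).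
Proof. by move=> us km; have [_] := entry_col_spec us km; apply. Qed.

(** A minimum left of and below the entry has its index between the row and the column, so every
    entry falls inside the staircase. *)
Lemma entry_row_col s k : uniq s -> nonmin s k -> entry_row s k <= entry_col s k.
Proof.
move=> us km; have [j js []] := lrmin_lt us km.
by rewrite lrmin_pos_lt // lrmin_val_lt // => jc rj; apply: leq_trans rj jc.
Qed.

Lemma entry_col_mono s k l : uniq s -> nonmin s k -> nonmin s l -> k <= l ->
  entry_col s k <= entry_col s l.
Proof.
move=> us km lm kl; have cs := entry_col_lt us km.
by rewrite -lrmin_pos_lt //; apply: leq_trans kl; rewrite lrmin_pos_lt.
Qed.

Lemma entry_row_mono s k l : uniq s -> nonmin s k -> nth 0 s k <= nth 0 s l ->
  entry_row s l <= entry_row s k.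
Proof.
move=> us km kl; have rs := entry_row_lt us km.
by rewrite -lrmin_val_lt //; apply: leq_trans kl; rewrite lrmin_val_lt.
Qed.

Lemma nth_uniq_lt s k l : uniq s -> k < size s -> l < size s ->
  k != l -> (nth 0 s k < nth 0 s l) = ~~ (nth 0 s l < nth 0 s k).
Proof.
by move=> us ks ls kl; rewrite -leqNgt [RHS]leq_eqVlt nth_uniq // (negbTE kl).
Qed.

(** * Cells of entries and contents of cells *)

Definition cell_pos s i j :=
  [seq k <- iota 0 (size s) |
    [&& ~~ is_lrmin s k, entry_row s k == i & entry_col s k == j]].

Lemma cell_entriesE s i j : cell_entries s i j = [seq nth 0 s k | k <- cell_pos s i j].
Proof. by []. Qed.

Lemma mem_cell_pos s i j k :
  (k \in cell_pos s i j) = [&& nonmin s k, entry_row s k == i & entry_col s k == j].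
Proof. by rewrite mem_filter mem_iota add0n /nonmin /= andbC !andbA. Qed.

Lemma sorted_cell_pos s i j : sorted ltn (cell_pos s i j).
Proof. by apply: sorted_filter; [exact: ltn_trans|exact: iota_ltn_sorted]. Qed.

Lemma uniq_cell_entries s i j : uniq s -> uniq (cell_entries s i j).
Proof.
move=> us; rewrite cell_entriesE map_inj_in_uniq ?filter_uniq ?iota_uniq // => k l.
rewrite !mem_cell_pos => /andP[/andP[ks _] _] /andP[/andP[ls _] _] /eqP.
by rewrite nth_uniq // => /eqP.
Qed.

(** Standardizing keeps the relative order; [nth] and [index] on the list of positions of the cell
    translate between the two kinds of occurrence. *)
Lemma SE_contains n s (c : cell n) q :
  contains (SE n s c) q <->
  exists2 f, embeds s q f & forall i, i < size q -> f i \in cell_pos s (crow c) (ccol c).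
Proof.
rewrite ffunE cell_entriesE; set ks := cell_pos _ _ _.
have sk : sorted ltn ks := sorted_cell_pos _ _ _.
have kss k : k \in ks -> k < size s by rewrite mem_cell_pos => /andP[/andP[]].
split=> [/containsP[f []]|[f [f_mono f_lt f_ord] f_in]].
  rewrite size_standardize size_map => f_mono f_lt f_ord.
  exists (fun i => nth 0 ks (f i)); last by move=> i iq; rewrite mem_nth ?f_lt.
  split=> [i j /andP[ij jq]|i iq|i j iq jq].
  - by rewrite nth_ltn_sorted ?f_mono ?ij ?f_lt.
  - by rewrite kss // mem_nth ?f_lt.
  - by rewrite -f_ord // standardize_lt ?size_map ?f_lt // !(nth_map 0) ?f_lt.
apply/containsP; exists (fun i => index (f i) ks); split=> [i j /andP[ij jq]|i iq|i j iq jq].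
- by rewrite index_ltn_sorted ?f_in ?f_mono ?ij // (ltn_trans ij).
- by rewrite size_standardize size_map index_mem f_in.
- rewrite standardize_lt ?size_map ?index_mem ?f_in //.
  by rewrite !(nth_map 0) ?index_mem ?f_in // !nth_index ?f_in // f_ord.
Qed.

Lemma SE_nonempty n s (c : cell n) :
  (SE n s c != [::]) = (cell_pos s (crow c) (ccol c) != [::]).
Proof.
by rewrite -!size_eq0 ffunE size_standardize cell_entriesE size_map.
Qed.

Lemma SE_nonemptyP n s (c : cell n) :
  reflect (exists k, k \in cell_pos s (crow c) (ccol c)) (c \in nonempty_cells (SE n s)).
Proof.
rewrite inE SE_nonempty; apply: (iffP idP) => [|[k]].
  by case: (cell_pos _ _ _) => // k t _; exists k; rewrite mem_head.
by case: (cell_pos _ _ _).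
Qed.

Lemma cell_of n s k : uniq s -> size (lrmin_pos s) = n -> nonmin s k ->
  exists c : cell n, [/\ crow c = entry_row s k :> nat, ccol c = entry_col s k :> nat &
    k \in cell_pos s (crow c) (ccol c)].
Proof.
move=> us <- km; have rs := entry_row_lt us km; have cs := entry_col_lt us km.
have rc : inB (Ordinal rs, Ordinal cs) by rewrite /inB /= entry_row_col.
exists (exist (fun c => inB c) _ rc); split=> //.
by rewrite mem_cell_pos km !eqxx.
Qed.

Lemma cell_eq n (c d : cell n) :
  crow c = crow d :> nat -> ccol c = ccol d :> nat -> c = d.
Proof.
move=> er ec; apply: val_inj; case: c d er ec => [[a b] ab] [[a' b'] ab'] /= er ec.
by congr (_, _); exact: val_inj.
Qed.

Lemma lrmin_pos_neq s k j : nonmin s k -> j < size (lrmin_pos s) ->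
  nth 0 (lrmin_pos s) j != k.
Proof.
move=> /andP[_ km] /nth_lrmin_pos[_]; by apply: contraTneq => ->.
Qed.

Lemma lt_lrmin_pos s k j : uniq s -> nonmin s k -> j < size (lrmin_pos s) ->
  (k < nth 0 (lrmin_pos s) j) = (entry_col s k < j).
Proof.
move=> us km js; have := lrmin_pos_lt us km js; have := lrmin_pos_neq km js; lia.
Qed.

Lemma lt_lrmin_val s k j : uniq s -> nonmin s k -> j < size (lrmin_pos s) ->
  (nth 0 s k < nth 0 (lrmin_val s) j) = (j < entry_row s k).
Proof.
move=> us km js; rewrite ltnNge leq_eqVlt lrmin_val_lt // nth_lrmin_val //.
have [ps _] := nth_lrmin_pos js; have ks : k < size s by case/andP: km.
by rewrite nth_uniq // (negbTE (lrmin_pos_neq km js)) -ltnNge.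
Qed.

(** * From avoiders to fillings *)

Definition row_increasing s := forall k l, nonmin s k -> nonmin s l ->
  entry_row s k = entry_row s l -> entry_col s k < entry_col s l ->
  nth 0 s k < nth 0 s l.

(** Independence phrased for pairs of entries: the three clauses exclude up edges, down edges and
    edges within a column. *)
Definition UDC_free s := forall k l, nonmin s k -> nonmin s l ->
  [/\ ~~ ((entry_row s l < entry_row s k) && (entry_col s k < entry_col s l)),
      ~~ [&& entry_row s k < entry_row s l, entry_col s k < entry_col s l
           & entry_row s l <= entry_col s k] &
      entry_col s k = entry_col s l -> entry_row s k = entry_row s l].

(** The lower left corner [(k, j)] is the first cell of the rectangle to leave the staircase. *)
Lemma rect_inBE n (i k j l : 'I_n) : i <= k -> j <= l -> rect_inB i k j l = (k <= j).
Proof.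
move=> ik jl; apply/idP/idP => [/forallP/(_ k)/forallP/(_ j)|kj].
  by rewrite ik jl !leqnn.
apply/forallP => a; apply/forallP => b; apply/implyP.
by rewrite /inB /= => /andP[/andP[_ ak] /andP[jb _]]; rewrite (leq_trans ak) ?(leq_trans kj).
Qed.

Lemma SE_independent n s : uniq s -> size (lrmin_pos s) = n ->
  independent (@UDC n) (nonempty_cells (SE n s)) <-> UDC_free s.
Proof.
move=> us sn; split=> [ind k l km lm|free u v].
  have [c [rc cc kc]] := cell_of us sn km; have [d [rd cd ld]] := cell_of us sn lm.
  have cN : c \in nonempty_cells (SE n s) by apply/SE_nonemptyP; exists k.
  have dN : d \in nonempty_cells (SE n s) by apply/SE_nonemptyP; exists l.
  have := ind _ _ cN dN; rewrite /UDC negb_and negbK -rc -cc -rd -cd => /orP[/eqP->|].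
    by rewrite !ltnn.
  rewrite !negb_or /up_adj /down_adj => /and5P[h1 _ h3 _ h5]; split=> //.
    apply: contra h3 => /and3P[a b e]; rewrite a b rect_inBE //; exact: ltnW.
  by move/val_inj=> e; rewrite e eqxx in h5.
case/SE_nonemptyP=> k; rewrite mem_cell_pos => /and3P[km /eqP rk /eqP ck].
case/SE_nonemptyP=> l; rewrite mem_cell_pos => /and3P[lm /eqP rl /eqP cl].
have [a1 a2 a3] := free _ _ km lm; have [b1 b2 _] := free _ _ lm km.
rewrite rk ck rl cl in a1 a2 a3 b1 b2.
rewrite /UDC negb_and negbK; have [//|uv] := eqVneq u v; rewrite /= !negb_or /up_adj /down_adj.
rewrite a1 b1 /=; apply/and3P; split.
- by apply: contra a2 => /and3P[e f]; rewrite e f rect_inBE //; exact: ltnW.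
- by apply: contra b2 => /and3P[e f]; rewrite e f rect_inBE //; exact: ltnW.
- apply: contraNneq uv => e; apply/eqP/cell_eq; last by rewrite e.
  by apply: a3; rewrite e.
Qed.

Lemma contains_pos s ks p : sorted ltn ks -> all (fun k => k < size s) ks ->
  order_iso [seq nth 0 s k | k <- ks] p -> contains s p.
Proof.
move=> sk ak iso; exists [seq nth 0 s k | k <- ks] => //.
by rewrite -[X in subseq _ X](mkseq_nth 0 s); apply/map_subseq/sorted_subseq_iota.
Qed.

Ltac order_iso4 :=
  by split=> // -[|[|[|[|?]]]] [|[|[|[|?]]]] //=; lia.

Section Positions4.
Variables (s : seq nat) (a b c d : nat).
Hypothesis abcd : [&& a < b, b < c, c < d & d < size s].

Let sorted4 : sorted ltn [:: a; b; c; d]. Proof. by move: abcd => /=; lia. Qed.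
Let all4 : all (fun k => k < size s) [:: a; b; c; d]. Proof. by move: abcd => /=; lia. Qed.

Lemma contains_2413 : nth 0 s c < nth 0 s a -> nth 0 s a < nth 0 s d ->
  nth 0 s d < nth 0 s b -> contains s [:: 2; 4; 1; 3].
Proof. by move=> h1 h2 h3; apply: (contains_pos sorted4 all4) => /=; order_iso4. Qed.

Lemma contains_3142 : nth 0 s b < nth 0 s d -> nth 0 s d < nth 0 s a ->
  nth 0 s a < nth 0 s c -> contains s [:: 3; 1; 4; 2].
Proof. by move=> h1 h2 h3; apply: (contains_pos sorted4 all4) => /=; order_iso4. Qed.

Lemma contains_3124 : nth 0 s b < nth 0 s c -> nth 0 s c < nth 0 s a ->
  nth 0 s a < nth 0 s d -> contains s [:: 3; 1; 2; 4].
Proof. by move=> h1 h2 h3; apply: (contains_pos sorted4 all4) => /=; order_iso4. Qed.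

End Positions4.

Section AvoidersForward.
Variables (s : seq nat) (us : uniq s).
Hypothesis no2413 : ~ contains s [:: 2; 4; 1; 3].
Hypothesis no3142 : ~ contains s [:: 3; 1; 4; 2].
Hypothesis no3124 : ~ contains s [:: 3; 1; 2; 4].

Let p := nth 0 (lrmin_pos s).

(** If [l] were below [k], then the minimum of their row, [k], the minimum that opens the column of
    [l], and [l] would form 2413. *)
Lemma row_increasing_of_avoid : row_increasing s.
Proof.
move=> k l km lm rkl ckl.
have [ks _] := andP km; have [ls _] := andP lm.
rewrite nth_uniq_lt //; last by apply: contraTneq ckl => ->; rewrite ltnn.
apply/negP => slk; apply: no2413.
have rN := entry_row_lt us lm; have cN := entry_col_lt us lm.
have rc := entry_row_col us km; rewrite rkl in rc.
apply: (@contains_2413 s (p (entry_row s l)) k (p (entry_col s l)) l) => //.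
- by rewrite ls !lrmin_pos_lt // lt_lrmin_pos // rc ckl leqnn.
- by rewrite -!nth_lrmin_val // ltn_lrmin_val // (leq_ltn_trans rc).
- by rewrite -nth_lrmin_val // lrmin_val_lt.
Qed.

Lemma UDC_free_of_avoid : UDC_free s.
Proof.
move=> k l km lm.
have [ks _] := andP km; have [ls _] := andP lm.
have rkN := entry_row_lt us km; have ckN := entry_col_lt us km.
have rlN := entry_row_lt us lm; have clN := entry_col_lt us lm.
have rck := entry_row_col us km; have rcl := entry_row_col us lm.
split.
(* An up edge: the minima of the rows of [l] and of [k], followed by [k] and [l], form 3124. *)
- apply/negP => /andP[r_lt c_lt]; apply: no3124.
  apply: (@contains_3124 s (p (entry_row s l)) (p (entry_row s k)) k l).
  + rewrite ls ltn_lrmin_pos // lrmin_pos_lt // r_lt rck andbT /=.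
    by rewrite (ltn_trans (_ : k < p (entry_col s l))) ?lt_lrmin_pos ?lrmin_pos_lt.
  + by rewrite -nth_lrmin_val // lrmin_val_lt.
  + by rewrite -nth_lrmin_val // lt_lrmin_val.
  + by rewrite -nth_lrmin_val // lrmin_val_lt.
(* A down edge: [rc] puts the minimum of the row of [l] before [k]; with [k], the minimum of the
   column of [l], and [l] it forms 2413. *)
- apply/negP => /and3P[r_lt c_lt rc]; apply: no2413.
  apply: (@contains_2413 s (p (entry_row s l)) k (p (entry_col s l)) l).
  + by rewrite ls !lrmin_pos_lt // lt_lrmin_pos // rc c_lt leqnn.
  + by rewrite -!nth_lrmin_val // ltn_lrmin_val // (leq_ltn_trans rc).
  + by rewrite -nth_lrmin_val // lrmin_val_lt.
  + apply: (@ltn_trans (nth 0 (lrmin_val s) (entry_row s k))).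
      by rewrite lt_lrmin_val.
    by rewrite lrmin_val_lt.
- move=> ckl.
  (* Two rows meeting one column: their minima play 31, and the two entries complete 3142 or 3124
     according to which comes first. *)
  have main k' l' : nonmin s k' -> nonmin s l' -> entry_col s k' = entry_col s l' ->
      ~ entry_row s k' < entry_row s l'.
    move=> k'm l'm cE r_lt.
    have [k's _] := andP k'm; have [l's _] := andP l'm.
    have rk'N := entry_row_lt us k'm; have rl'N := entry_row_lt us l'm.
    have rcl' := entry_row_col us l'm.
    have hp : p (entry_row s k') < p (entry_row s l') by rewrite ltn_lrmin_pos.
    have hpk : p (entry_row s l') < k' by rewrite lrmin_pos_lt // cE.
    have hpl : p (entry_row s l') < l' by rewrite lrmin_pos_lt.
    have h1 : nth 0 s (p (entry_row s l')) < nth 0 s l'.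
      by rewrite -nth_lrmin_val // lrmin_val_lt.
    have h2 : nth 0 s l' < nth 0 s (p (entry_row s k')).
      by rewrite -nth_lrmin_val // lt_lrmin_val.
    have h3 : nth 0 s (p (entry_row s k')) < nth 0 s k'.
      by rewrite -nth_lrmin_val // lrmin_val_lt.
    have [kl'|lk'|e] := ltngtP k' l'.
    + apply: no3142.
      apply: (@contains_3142 s (p (entry_row s k')) (p (entry_row s l')) k' l') => //.
      by rewrite hp hpk kl'.
    + apply: no3124.
      apply: (@contains_3124 s (p (entry_row s k')) (p (entry_row s l')) l' k') => //.
      by rewrite hp hpl lk'.
    + by rewrite e ltnn in r_lt.
  by have := main _ _ km lm ckl; have := main _ _ lm km (esym ckl); lia.
Qed.

End AvoidersForward.

Lemma is_perm_nth p i : is_perm p -> i < size p -> 0 < nth 0 p i <= size p.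
Proof. by move=> pp ip; rewrite -is_perm_mem // mem_nth. Qed.

Lemma contains_oplus1l s p f k0 : is_perm p -> embeds s p f -> k0 < size s ->
  (forall i, i < size p -> k0 < f i /\ nth 0 s k0 < nth 0 s (f i)) ->
  contains s (oplus [:: 1] p).
Proof.
move=> pp [f_mono f_lt f_ord] k0s above; apply/containsP.
exists (fun i => if i is i'.+1 then f i' else k0); rewrite /oplus /= /embeds /= size_map.
split=> [[|i] [|j]|[|i]|[|i] [|j]] //=.
- by move=> jp; apply: (above j _).1.
- exact: f_mono.
- exact: f_lt.
- by rewrite !ltnn.
- move=> _ jp; rewrite (nth_map 0) // addn1 ltnS (above j jp).2.
  by case/andP: (is_perm_nth pp jp) => ->.
- move=> ip _; rewrite (nth_map 0) // addn1 ltnS ltn0.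
  by apply/negbTE; rewrite -leqNgt ltnW ?(above i ip).2.
- by move=> ip jp; rewrite !(nth_map 0) // f_ord // ltn_add2r.
Qed.

Lemma embeds_oplus1r s a f l : is_perm a -> embeds s a f -> l < size s ->
  (forall i, i < size a -> f i < l /\ nth 0 s (f i) < nth 0 s l) ->
  embeds s (oplus a [:: 1]) (fun i => if i < size a then f i else l).
Proof.
move=> pa [f_mono f_lt f_ord] ls below.
have szE : size (oplus a [:: 1]) = (size a).+1 by rewrite size_cat addn1.
have nthE i : i <= size a -> nth 0 (oplus a [:: 1]) i =
    if i < size a then nth 0 a i else (size a).+1.
  by move=> ia; rewrite nth_cat; case: ltnP => // ai; rewrite (_ : i - size a = 0) ?add1n //; lia.
split=> [i j|i|i j]; rewrite szE.
- move=> /andP[ij]; rewrite ltnS => ja; rewrite (leq_trans ij ja).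
  case: (ltnP j) => [ja'|_]; first by apply: f_mono; rewrite ij.
  by apply: (below i _).1; apply: leq_trans ij ja.
- by rewrite ltnS; case: (ltnP i) => // ia _; apply: f_lt.
- rewrite !ltnS => ia ja; rewrite !nthE //.
  case: (ltnP i) => [ia'|_]; case: (ltnP j) => [ja'|_].
  + exact: f_ord.
  + rewrite (below i ia').2 ltnS; have := is_perm_nth pa ia'; lia.
  + have := (below j ja').2; have := is_perm_nth pa ja'; lia.
  + by rewrite !ltnn.
Qed.

Lemma barP p : bar p = p \/ is_perm (bar p) /\ p = oplus (bar p) [:: 1].
Proof.
rewrite /bar; case: ifP => [/andP[pa /eqP pE]|_]; last by left.
by right.
Qed.

(** Makes the labels usable through entries: [LabelY] supplies a later entry to complete a pattern,
    [LabelZ] keeps the entries of the row from going beyond [c]. *)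
Lemma rhoP n s (c : cell n) :
  match rho c (nonempty_cells (SE n s)) with
  | LabelY => exists2 l, nonmin s l &
      entry_row s l = crow c :> nat /\ (ccol c < entry_col s l)%N
  | LabelZ => uniq s -> size (lrmin_pos s) = n ->
      forall l, nonmin s l -> entry_row s l = crow c -> entry_col s l <= ccol c
  end.
Proof.
rewrite /rho; case: ifP => [/exists_inP[u /SE_nonemptyP[l]]|/negbT].
  rewrite mem_cell_pos => /and3P[lm /eqP rl /eqP cl] /andP[/eqP ru cu].
  by exists l; rewrite // rl cl ru.
move=> none us sn l lm rl; rewrite leqNgt; apply: contra none => cl.
have [u [ru cu lu]] := cell_of us sn lm.
apply/exists_inP; exists u; first by apply/SE_nonemptyP; exists l.
rewrite cu cl andbT; apply/eqP/val_inj => /=; congruence.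
Qed.

Lemma SE_is_perm n s (c : cell n) : uniq s -> is_perm (SE n s c).
Proof. by move=> us; rewrite ffunE is_perm_standardize ?uniq_cell_entries. Qed.

Section Forward.
Variables (P : set (seq nat)) (n : nat) (s : seq nat).
Hypothesis P_perm : forall p, P p -> is_perm p /\ p <> [::].
Hypothesis sn : size (lrmin_pos s) = n.
Hypothesis sAv : Av ([set [:: 2; 4; 1; 3]; [:: 3; 1; 4; 2]; [:: 3; 1; 2; 4]]
            `|` (oplus [:: 1] @` P)) s.

Let us : uniq s. Proof. exact: is_perm_uniq sAv.1. Qed.

Let no2413 : ~ contains s [:: 2; 4; 1; 3].
Proof. by apply: sAv.2; left; left; left. Qed.

Let no3142 : ~ contains s [:: 3; 1; 4; 2].
Proof. by apply: sAv.2; left; left; right. Qed.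

Let no3124 : ~ contains s [:: 3; 1; 2; 4].
Proof. by apply: sAv.2; left; right. Qed.

Lemma Av_row_increasing : row_increasing s.
Proof. exact: row_increasing_of_avoid. Qed.

Lemma Av_UDC_free : UDC_free s.
Proof. exact: UDC_free_of_avoid. Qed.

(* The left-to-right minimum of row [crow c] plays the role of the [1] of [oplus [:: 1] p]. *)
Let no_above (c : cell n) p f : P p -> embeds s p f ->
  (forall i, i < size p -> [/\ nonmin s (f i), entry_row s (f i) = crow c
    & crow c <= entry_col s (f i)]) -> False.
Proof.
move=> Pp ef f_in; have [pp _] := P_perm Pp.
have cN : crow c < size (lrmin_pos s) by rewrite sn.
have [ps _] := nth_lrmin_pos cN.
apply: (sAv.2 (oplus [:: 1] p)); first by right; exists p.
apply: (contains_oplus1l pp ef ps) => i ip; have [fm fr fc] := f_in i ip.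
by rewrite lrmin_pos_lt // -nth_lrmin_val // lrmin_val_lt // fr.
Qed.

Lemma SE_mapsto_WI :
  WI (@rho n) (@UDC n)
       (Avp ([set [:: 3; 1; 2]] `|` (bar @` P)))
       (Avp ([set [:: 2; 4; 1; 3]; [:: 3; 1; 4; 2]; [:: 3; 1; 2; 4]] `|` P)) (SE n s).
Proof.
split; first exact/(SE_independent us sn)/Av_UDC_free.
move=> c cN; have ne : SE n s c <> [::] by apply/eqP; move: cN; rewrite inE.
have sub q : contains (SE n s c) q -> contains s q.
  by case/SE_contains=> f ef _; apply/containsP; exists f.
have inc k : k \in cell_pos s (crow c) (ccol c) ->
    [/\ nonmin s k, entry_row s k = crow c & entry_col s k = ccol c].
  by rewrite mem_cell_pos => /and3P[km /eqP kr /eqP kc].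
have crc : crow c <= ccol c by have := valP c.
have noP q : P q -> ~ contains (SE n s c) q.
  move=> Pq /SE_contains[f ef f_in]; apply: (@no_above c _ _ Pq ef) => i iq.
  by have [fm fr fc] := inc _ (f_in i iq); rewrite fr fc.
have := rhoP s c; case: (rho _ _) => [[l lm [lr lc]]|_]; split=> //; split; rewrite ?SE_is_perm //.
  have ls : l < size s by case/andP: lm.
  (* Its later column puts [l] to the right of the cell and increasing rows put it above, so [l] can
     serve as the final maximum of a pattern. *)
  have lkc k : k \in cell_pos s (crow c) (ccol c) -> k < l /\ nth 0 s k < nth 0 s l.
    move=> /inc[km kr kc]; split; last by apply: Av_row_increasing; rewrite ?kr ?kc.
    rewrite ltnNge; apply/negP => /(entry_col_mono us lm km).
    by rewrite kc leqNgt lc.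
  move=> q [->|[q' Pq' <-]].
    (* A 312 in the cell, followed by [l], would be 3124. *)
    move=> /SE_contains[f [f_mono f_lt f_ord] f_in]; apply: no3124.
    have [f0 f1 f2] : [/\ f 0 \in cell_pos s (crow c) (ccol c),
      f 1 \in cell_pos s (crow c) (ccol c) & f 2 \in cell_pos s (crow c) (ccol c)].
      by split; apply: f_in.
    apply: (@contains_3124 s (f 0) (f 1) (f 2) l).
    + by rewrite !f_mono //= (lkc _ f2).1.
    + by rewrite f_ord.
    + by rewrite f_ord.
    + exact: (lkc _ f0).2.
  have [->|[pq qE]] := barP q'; first exact: noP.
  (* Here [bar] has removed a final maximum, and [l] restores it. *)
  move=> /SE_contains[f ef f_in].
  have eg := embeds_oplus1r pq ef ls (fun i iq => lkc _ (f_in i iq)); rewrite -qE in eg.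
  apply: (@no_above c _ _ Pq' eg) => i _; case: ifP => [iq|_].
    by have [fm fr fc] := inc _ (f_in i iq); rewrite fr fc.
  by rewrite lr (leq_trans crc) // ltnW.
move=> q [q3|]; last exact: noP.
by move/sub; apply: sAv.2; left.
Qed.

End Forward.

(** * From fillings to avoiders *)

(** Such a cut forces the first [t] entries to be the values 1 to [t], and [q] is then the sum of
    its two parts. *)
Lemma sum_indecomposable_cut q t : is_perm q -> sum_indecomposable q -> 0 < t < size q ->
  ~ (forall i j, i < t -> t <= j < size q -> nth 0 q i < nth 0 q j).
Proof.
move=> pq ind /andP[t0 tq] cut; apply: ind.
have uq := is_perm_uniq pq.
have st : size (take t q) = t by rewrite size_take tq.
have cut' x y : x \in take t q -> y \in drop t q -> x < y.
  move=> /(nthP 0)[i]; rewrite st => it <- /(nthP 0)[j]; rewrite size_drop => jq <-.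
  by rewrite nth_take // nth_drop; apply: cut => //; rewrite leq_addr -ltn_subRL.
have ut : uniq (take t q) by exact: take_uniq.
have pt : is_perm (take t q).
  apply: is_perm_subset => // x xt.
  have : 0 < x <= size q by rewrite -is_perm_mem // (mem_take xt).
  case/andP=> -> xq /=.
  (* All values from 1 to [x] occur before the cut, where there are only [t] places; hence
     [x <= t]. *)
  rewrite -[leqLHS](size_iota 1); apply: uniq_leq_size; first exact: iota_uniq.
  move=> y; rewrite mem_iota add1n ltnS => /andP[y0 yx].
  have : y \in q by rewrite is_perm_mem // y0 (leq_trans yx).
  rewrite -[q in _ \in q](cat_take_drop t) mem_cat => /orP[//|yd].
  by have := cut' _ _ xt yd; rewrite ltnNge yx.
have dt x : x \in drop t q -> t < x <= size q.
  move=> xd; have : 0 < x <= size q by rewrite -is_perm_mem // (mem_drop xd).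
  case/andP=> x0 ->; rewrite andbT ltnNge; apply/negP => xt.
  have xt' : x \in take t q by rewrite is_perm_mem // st x0.
  by have := cut' _ _ xt' xd; rewrite ltnn.
exists (take t q), [seq x - t | x <- drop t q]; split=> //.
- apply: is_perm_subset.
    rewrite map_inj_in_uniq ?drop_uniq // => x y /dt/andP[tx _] /dt/andP[ty _] e.
    by rewrite -(subnK (ltnW tx)) e subnK // ltnW.
  by move=> y /mapP[x /dt/andP[tx xq] ->]; rewrite size_map size_drop subn_gt0 tx leq_sub2r.
- by move=> e; move: t0; rewrite -st e.
- by move/(congr1 size)/eqP; rewrite size_map size_drop subn_eq0 leqNgt tq.
- rewrite /oplus st -map_comp -[LHS](cat_take_drop t); congr (_ ++ _).
  by rewrite -[LHS]map_id; apply/eq_in_map => x /dt/andP[tx _] /=; rewrite subnK // ltnW.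
Qed.

Definition in_cell_of s k i :=
  [/\ nonmin s i, entry_row s i = entry_row s k & entry_col s i = entry_col s k].

(** * Cells of entries under independence and increasing rows *)

Section Geometry.
Variables (s : seq nat) (us : uniq s).
Hypothesis free : UDC_free s.
Hypothesis incr : row_increasing s.

Lemma above_lrmin_nonmin p k : p < k -> k < size s -> nth 0 s p < nth 0 s k -> nonmin s k.
Proof.
move=> pk ks spk; rewrite /nonmin ks; apply/negP => /is_lrminP/(_ _ pk).
by rewrite ltnNge ltnW.
Qed.

(** If [j] is the index of [p], both cells have row at most [j] and column at least [j], so a
    rectangle spanned by them stays in the staircase. Cells in different rows would then be joined
    by an edge of one of the three kinds. *)
Lemma above_lrmin_same_row p k l : is_lrmin s p ->
  p < k -> k < size s -> nth 0 s p < nth 0 s k ->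
  p < l -> l < size s -> nth 0 s p < nth 0 s l ->
  entry_row s k = entry_row s l.
Proof.
move=> pm pk ks spk pl ls spl.
have km := above_lrmin_nonmin pk ks spk; have lm := above_lrmin_nonmin pl ls spl.
have [j jN jp] := lrmin_pos_ex (ltn_trans pk ks) pm.
move: pk spk pl spl; rewrite -jp -nth_lrmin_val // !lrmin_val_lt // !lrmin_pos_lt //.
move=> a1 a2 a3 a4; have [b1 b2 b3] := free km lm; have [c1 c2 c3] := free lm km.
lia.
Qed.

Lemma lrmin_separates p k l : p < size s -> is_lrmin s p -> nonmin s k -> nonmin s l ->
  nth 0 s k < nth 0 s p -> nth 0 s p < nth 0 s l -> entry_row s k <> entry_row s l.
Proof.
move=> ps pm km lm; have [j jN <-] := lrmin_pos_ex ps pm.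
by rewrite -nth_lrmin_val // lt_lrmin_val // lrmin_val_lt //; lia.
Qed.

Lemma descent_same_col k l : nonmin s k -> nonmin s l -> entry_row s k = entry_row s l ->
  k < l -> nth 0 s l < nth 0 s k -> entry_col s k = entry_col s l.
Proof.
move=> km lm rkl kl slk; have := entry_col_mono us km lm (ltnW kl).
rewrite leq_eqVlt => /orP[/eqP//|ckl].
by have := incr km lm rkl ckl; rewrite ltnNge ltnW.
Qed.

(** A column is the stretch of positions between consecutive minima, so everything between [k] and
    [l] lies in their column, which has only one non-empty cell. *)
Lemma between_same_cell k m l : nonmin s k -> nonmin s l -> entry_col s k = entry_col s l ->
  k < m -> m < l -> in_cell_of s k m.
Proof.
move=> km lm ckl ltkm ltml; have [ls _] := andP lm; have ms := ltn_trans ltml ls.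
have mm : nonmin s m.
  rewrite /nonmin ms; apply/negP => mm; have [j jN ej] := lrmin_pos_ex ms mm.
  by move: ltkm ltml; rewrite -ej lt_lrmin_pos // lrmin_pos_lt // ckl; lia.
have cmk : entry_col s m = entry_col s k.
  have := entry_col_mono us km mm (ltnW ltkm); have := entry_col_mono us mm lm (ltnW ltml); lia.
by split=> //; have [_ _ ->] := free mm km.
Qed.

End Geometry.

Lemma embeds_312 s a b c : [&& a < b, b < c & c < size s] ->
  nth 0 s b < nth 0 s c -> nth 0 s c < nth 0 s a ->
  embeds s [:: 3; 1; 2] (nth 0 [:: a; b; c]).
Proof.
move=> abc bc ca; split.
- by move=> [|[|[|i]]] [|[|[|j]]] //=; lia.
- by move=> [|[|[|i]]] //=; lia.
- by move=> [|[|[|i]]] [|[|[|j]]] //=; lia.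
Qed.

Section Backward.
Variables (P : set (seq nat)) (n : nat) (s : seq nat).
Hypothesis P_perm : forall p, P p -> is_perm p /\ p <> [::].
Hypothesis P_indec : forall p, (bar @` P) p -> sum_indecomposable p.
Hypothesis sn : size (lrmin_pos s) = n.
Hypothesis us : uniq s.
Hypothesis incr : row_increasing s.
Let Y := Avp ([set [:: 3; 1; 2]] `|` (bar @` P)).
Let Z := Avp ([set [:: 2; 4; 1; 3]; [:: 3; 1; 4; 2]; [:: 3; 1; 2; 4]] `|` P).
Hypothesis sWI : WI (@rho n) (@UDC n) Y Z (SE n s).

Let free : UDC_free s. Proof. by case: sWI => /(SE_independent us sn). Qed.

(** The two labels restated for occurrences in [s]. In the second alternative the bound on columns
    pulls the later entries of the row into the cell. *)
Lemma cell_classes k : nonmin s k ->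
  (forall q f, ([set [:: 3; 1; 2]] `|` (bar @` P)) q -> embeds s q f ->
     (forall i, i < size q -> in_cell_of s k (f i)) -> False)
  \/ (forall q f, ([set [:: 2; 4; 1; 3]; [:: 3; 1; 4; 2]; [:: 3; 1; 2; 4]] `|` P) q ->
        embeds s q f -> (forall i, i < size q -> in_cell_of s k (f i)) -> False)
     /\ (forall l, nonmin s l -> entry_row s l = entry_row s k -> entry_col s l <= entry_col s k).
Proof.
move=> km; have [c [rc cc kc]] := cell_of us sn km.
have cN : c \in nonempty_cells (SE n s) by apply/SE_nonemptyP; exists k.
have inc q f : embeds s q f -> (forall i, i < size q -> in_cell_of s k (f i)) ->
    contains (SE n s c) q.
  move=> ef f_in; apply/SE_contains; exists f => // i iq.
  by have [fm fr fc] := f_in i iq; rewrite mem_cell_pos fm fr fc rc cc !eqxx.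
have := sWI.2 c cN; have := rhoP s c; case: (rho _ _) => [_|right] [[_ av] _]; [left|right].
  by move=> q f Qq ef f_in; apply: av Qq (inc _ _ ef f_in).
split; first by move=> q f Qq ef f_in; apply: av Qq (inc _ _ ef f_in).
by move=> l lm lr; rewrite -cc; apply: right => //; rewrite lr rc.
Qed.

Lemma cell_no_312 a b c : nonmin s a -> in_cell_of s a b -> in_cell_of s a c ->
  a < b -> b < c -> nth 0 s b < nth 0 s c -> nth 0 s c < nth 0 s a ->
  (forall q f, ([set [:: 2; 4; 1; 3]; [:: 3; 1; 4; 2]; [:: 3; 1; 2; 4]] `|` P) q ->
        embeds s q f -> (forall i, i < size q -> in_cell_of s a (f i)) -> False)
     /\ (forall l, nonmin s l -> entry_row s l = entry_row s a -> entry_col s l <= entry_col s a).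
Proof.
move=> am ab ac ltab ltbc sbc sca; have [noY|//] := cell_classes am.
have cs : c < size s by case: ac => /andP[].
case: (noY [:: 3; 1; 2] (nth 0 [:: a; b; c])); first by left.
  by apply: embeds_312; rewrite // ltab ltbc.
by case=> [|[|[|i]]].
Qed.

(** The last clause prepares a case split: [c] lies above [m], or [m] separates the row of [c] from
    those of the entries above [m]. *)
Lemma lrmin_below_lt k c : k < c -> c < size s -> exists m,
  [/\ m <= k, is_lrmin s m, nth 0 s m <= nth 0 s k &
      nth 0 s m < nth 0 s c \/ nth 0 s c < nth 0 s m].
Proof.
move=> kc cs; have [m [mk mm sm]] := lrmin_below s k; exists m; split=> //.
have mc := leq_ltn_trans mk kc.
apply/orP; rewrite -neq_ltn nth_uniq ?(ltn_trans mc cs) // neq_ltn mc //.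
Qed.

(** The letters 4 and 3 share a row and form a descent, so they share a column, and 1 lies between
    them; the descent 21 then draws in 2. The whole occurrence lies in one cell, which contains 312
    and so must avoid 2413. *)
Lemma avoids_2413 : ~ contains s [:: 2; 4; 1; 3].
Proof.
move=> /containsP[f ef]; have [f_mono f_lt f_ord] := ef.
have ab : f 0 < f 1 by exact: f_mono.
have bc : f 1 < f 2 by exact: f_mono.
have cd : f 2 < f 3 by exact: f_mono.
have ds : f 3 < size s by exact: f_lt.
have sca : nth 0 s (f 2) < nth 0 s (f 0) by rewrite f_ord.
have sad : nth 0 s (f 0) < nth 0 s (f 3) by rewrite f_ord.
have sdb : nth 0 s (f 3) < nth 0 s (f 1) by rewrite f_ord.
have bs := ltn_trans bc (ltn_trans cd ds); have cs := ltn_trans cd ds.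
have [m [ma mm sma smc]] := lrmin_below_lt (ltn_trans ab bc) cs.
have mb := leq_ltn_trans ma ab; have mc := ltn_trans mb bc; have md := ltn_trans mc cd.
have smd := leq_ltn_trans sma sad; have smb := ltn_trans smd sdb.
have bm := above_lrmin_nonmin mb bs smb.
have dm := above_lrmin_nonmin md ds smd.
have rbd := above_lrmin_same_row us free mm mb bs smb md ds smd.
have cbd := descent_same_col us incr bm dm rbd (ltn_trans bc cd) sdb.
have cb := between_same_cell us free bm dm cbd bc cd; have [cm rcb ccb] := cb.
(* A minimum above the letter 1 would separate it from 3, which is in the same row. *)
case: smc => smc; last first.
  by apply: (lrmin_separates us (ltn_trans mb bs) mm cm dm smc smd); rewrite rcb.
have ltma : m < f 0.
  by rewrite ltn_neqAle ma andbT; apply: contraTneq smc => ->; rewrite -leqNgt ltnW.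
have as_ := ltn_trans ab bs; have sma' := ltn_trans smc sca.
have am := above_lrmin_nonmin ltma as_ sma'.
have rab := above_lrmin_same_row us free mm ltma as_ sma' mb bs smb.
have cac := descent_same_col us incr am cm (etrans rab (esym rcb)) (ltn_trans ab bc) sca.
have [|noZ _] := cell_no_312 bm cb _ bc cd (ltn_trans sca sad) sdb; first by split.
apply: (noZ _ f _ ef); first by left; left; left.
by case=> [|[|[|[|i]]]] // _; split=> //; rewrite cac.
Qed.

(** A minimum weakly below 1 puts 4 and 2 in one row, hence, by the descent, in one cell. The
    descent 32 draws in 3, and 1 lies between 3 and 2; the letters 312 then put the cell in the
    class avoiding 3142. *)
Lemma avoids_3142 : ~ contains s [:: 3; 1; 4; 2].
Proof.
move=> /containsP[f ef]; have [f_mono f_lt f_ord] := ef.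
have ab : f 0 < f 1 by exact: f_mono.
have bc : f 1 < f 2 by exact: f_mono.
have cd : f 2 < f 3 by exact: f_mono.
have ds : f 3 < size s by exact: f_lt.
have sbd : nth 0 s (f 1) < nth 0 s (f 3) by rewrite f_ord.
have sda : nth 0 s (f 3) < nth 0 s (f 0) by rewrite f_ord.
have sac : nth 0 s (f 0) < nth 0 s (f 2) by rewrite f_ord.
have cs := ltn_trans cd ds; have bs := ltn_trans bc cs; have as_ := ltn_trans ab bs.
have bd := ltn_trans bc cd; have ad := ltn_trans ab bd; have sdc := ltn_trans sda sac.
have [m' [m'b m'm sm'b]] := lrmin_below s (f 1).
have m'c := leq_ltn_trans m'b bc; have m'd := ltn_trans m'c cd.
have sm'd := leq_ltn_trans sm'b sbd; have sm'c := ltn_trans sm'd sdc.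
have cm := above_lrmin_nonmin m'c cs sm'c.
have dm := above_lrmin_nonmin m'd ds sm'd.
have rcd := above_lrmin_same_row us free m'm m'c cs sm'c m'd ds sm'd.
have ccd := descent_same_col us incr cm dm rcd cd sdc.
have [m [ma mm sma smd]] := lrmin_below_lt ad ds.
have mc := leq_ltn_trans ma (ltn_trans ab bc); have md := ltn_trans mc cd.
have smc := leq_ltn_trans sma sac.
case: smd => smd; last first.
  by apply: (lrmin_separates us (ltn_trans md ds) mm dm cm smd smc).
have ltma : m < f 0.
  by rewrite ltn_neqAle ma andbT; apply: contraTneq smd => ->; rewrite -leqNgt ltnW.
have sma' := ltn_trans smd sda; have am := above_lrmin_nonmin ltma as_ sma'.
have rad := above_lrmin_same_row us free mm ltma as_ sma' md ds smd.
have cad := descent_same_col us incr am dm rad ad sda.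
have ba := between_same_cell us free am dm cad ab bd; have [bm rba cba] := ba.
have [|noZ _] := cell_no_312 am ba _ ab bd sbd sda; first by split.
apply: (noZ _ f _ ef); first by left; left; right.
by case=> [|[|[|[|i]]]] // _; split=> //; rewrite ?rcd ?ccd.
Qed.

(** The descent 32 lies in one cell, which then contains 1 as well. This 312 forces the cell to be
    the last of its row, so 4, being in the same row, lies in it too. *)
Lemma avoids_3124 : ~ contains s [:: 3; 1; 2; 4].
Proof.
move=> /containsP[f ef]; have [f_mono f_lt f_ord] := ef.
have ab : f 0 < f 1 by exact: f_mono.
have bc : f 1 < f 2 by exact: f_mono.
have cd : f 2 < f 3 by exact: f_mono.
have ds : f 3 < size s by exact: f_lt.
have sbc : nth 0 s (f 1) < nth 0 s (f 2) by rewrite f_ord.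
have sca : nth 0 s (f 2) < nth 0 s (f 0) by rewrite f_ord.
have sad : nth 0 s (f 0) < nth 0 s (f 3) by rewrite f_ord.
have cs := ltn_trans cd ds; have bs := ltn_trans bc cs; have as_ := ltn_trans ab bs.
have ac := ltn_trans ab bc; have ad := ltn_trans ac cd; have scd := ltn_trans sca sad.
have [m' [m'b m'm sm'b]] := lrmin_below s (f 1).
have m'c := leq_ltn_trans m'b bc; have m'd := ltn_trans m'c cd.
have sm'c := leq_ltn_trans sm'b sbc; have sm'd := ltn_trans sm'c scd.
have cm := above_lrmin_nonmin m'c cs sm'c.
have dm := above_lrmin_nonmin m'd ds sm'd.
have rcd := above_lrmin_same_row us free m'm m'c cs sm'c m'd ds sm'd.
have [m [ma mm sma smc]] := lrmin_below_lt ac cs.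
have mc := leq_ltn_trans ma ac; have md := ltn_trans mc cd.
have smd := leq_ltn_trans sma sad.
case: smc => smc; last first.
  by apply: (lrmin_separates us (ltn_trans md ds) mm cm dm smc smd).
have ltma : m < f 0.
  by rewrite ltn_neqAle ma andbT; apply: contraTneq smc => ->; rewrite -leqNgt ltnW.
have sma' := ltn_trans smc sca; have am := above_lrmin_nonmin ltma as_ sma'.
have rac := above_lrmin_same_row us free mm ltma as_ sma' mc cs smc.
have cac := descent_same_col us incr am cm rac ac sca.
have ba := between_same_cell us free am cm cac ab bc; have [bm rba cba] := ba.
have [|noZ last] := cell_no_312 am ba _ ab bc sbc sca; first by split.
apply: (noZ _ f _ ef); first by left; right.
have cda : entry_col s (f 3) = entry_col s (f 0).
  apply/eqP; rewrite eqn_leq last ?rac ?rcd //= (entry_col_mono us am dm) //; exact: ltnW.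
by case=> [|[|[|[|i]]]] // _; split=> //; rewrite rac rcd.
Qed.

(* An indecomposable pattern in an increasing row cannot straddle two columns. *)
Lemma indecomposable_in_cell q f : is_perm q -> sum_indecomposable q -> embeds s q f ->
  (forall i, i < size q -> nonmin s (f i) /\ entry_row s (f i) = entry_row s (f 0)) ->
  forall i, i < size q -> in_cell_of s (f 0) (f i).
Proof.
move=> pq indq [f_mono f_lt f_ord] f_row.
have f_col i j : i <= j -> j < size q -> entry_col s (f i) <= entry_col s (f j).
  rewrite leq_eqVlt => /orP[/eqP->//|ij] jq.
  apply: entry_col_mono => //; first by case: (f_row i (ltn_trans ij jq)).
    by case: (f_row j jq).
  by apply/ltnW/f_mono; rewrite ij.
move=> i iq; have [fm fr] := f_row i iq; split=> //; apply/eqP.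
apply/idPn => ci.
have exT : exists t, (t < size q) && (entry_col s (f t) != entry_col s (f 0)).
  by exists i; rewrite iq.
(* The first index in a later column is a cut: columns do not decrease along the occurrence, and
   increasing rows order the two sides. *)
case: (ex_minnP exT) => t /andP[tq ct] tmin.
have t0 : 0 < t by case: t ct {tq tmin} => //; rewrite eqxx.
apply: (sum_indecomposable_cut pq indq (t := t)); rewrite ?t0 // => k l kt /andP[tl lq].
have kq := ltn_trans kt tq.
have ck : entry_col s (f k) = entry_col s (f 0).
  apply/eqP; apply: contraTT kt => ck; rewrite -leqNgt; apply: tmin.
  by rewrite kq.
have [km rk] := f_row k kq; have [lm rl] := f_row l lq.
rewrite -f_ord //; apply: incr => //; first by rewrite rk rl.
apply: leq_trans (f_col _ _ tl lq); rewrite ck ltn_neqAle eq_sym ct.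
exact: f_col (ltnW t0) tq.
Qed.

Lemma bar_prefix p : P p -> [/\ is_perm (bar p), size (bar p) <= size p &
  forall f, embeds s p f -> embeds s (bar p) f].
Proof.
move=> Pp; have [pp _] := P_perm Pp.
have [->//|[pb pE]] := barP p.
have szE : size p = (size (bar p)).+1 by rewrite [in LHS]pE size_cat addn1.
have nthE i : i < size (bar p) -> nth 0 (bar p) i = nth 0 p i.
  by move=> ib; rewrite [in RHS]pE nth_cat ib.
split=> //; first by rewrite szE.
move=> f [f_mono f_lt f_ord]; split=> [i j /andP[ij jb]|i ib|i j ib jb].
- by apply: f_mono; rewrite ij szE ltnS ltnW.
- by apply: f_lt; rewrite szE ltnS ltnW.
- by rewrite !nthE // f_ord // szE ltnS ltnW.
Qed.

(** The occurrence of [p] lies in one row and its part [bar p] in one cell. That cell must avoid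
    [bar p], or it is the last of its row and then holds all of [p]. *)
Lemma avoids_oplus1 p : P p -> ~ contains s (oplus [:: 1] p).
Proof.
move=> Pp /containsP[g [g_mono g_lt g_ord]]; have [pp pne] := P_perm Pp.
rewrite /oplus /= size_map in g_mono g_lt g_ord.
pose f i := g i.+1.
have ef : embeds s p f.
  split=> [i j ij|i ip|i j ip jp]; [exact: g_mono|exact: g_lt|].
  by rewrite g_ord //= !(nth_map 0) // ltn_add2r.
have p0 : 0 < size p by rewrite lt0n size_eq0; exact/eqP.
(* The entry at [g 0] may fail to be a minimum; [m] replaces it. *)
have [m [mg mm smg]] := lrmin_below s (g 0).
have above i : i < size p -> [/\ m < f i, f i < size s & nth 0 s m < nth 0 s (f i)].
  move=> ip; split; [exact/(leq_ltn_trans mg)/g_mono|exact: g_lt|].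
  apply: leq_ltn_trans smg _; rewrite g_ord //= (nth_map 0) // addn1 ltnS.
  by case/andP: (is_perm_nth pp ip).
have f_row i : i < size p -> nonmin s (f i) /\ entry_row s (f i) = entry_row s (f 0).
  move=> ip; have [a1 a2 a3] := above i ip; have [b1 b2 b3] := above 0 p0.
  split; first exact: above_lrmin_nonmin a1 a2 a3.
  exact: (above_lrmin_same_row us free mm).
have [pb lebp bar_emb] := bar_prefix Pp.
have b_in : forall i, i < size (bar p) -> in_cell_of s (f 0) (f i).
  apply: indecomposable_in_cell => //; first by apply: P_indec; exists p.
    exact: bar_emb.
  by move=> i ib; apply: f_row; apply: leq_trans ib lebp.
have [f0m _] := f_row 0 p0.
(* For the one-point [p], [bar p] is empty and occurs in every cell, so the first alternative is
   contradictory there as well. *)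
have [noY|[noZ last]] := cell_classes f0m.
  by apply: (noY (bar p) f) => //; [right; exists p|exact: bar_emb].
apply: (noZ p f) => //; first by right.
move=> i ip; have [fm fr] := f_row i ip; split=> //.
apply/eqP; rewrite eqn_leq last //= (entry_col_mono us f0m fm) //.
by case: i ip {fm fr} => // i ip; apply/ltnW; apply: g_mono; exact: ip.
Qed.

Lemma WI_Av : is_perm s -> Av ([set [:: 2; 4; 1; 3]; [:: 3; 1; 4; 2]; [:: 3; 1; 2; 4]]
            `|` (oplus [:: 1] @` P)) s.
Proof.
move=> ps; split=> // q [[[->|->]|->]|[p Pp <-]].
- exact: avoids_2413.
- exact: avoids_3142.
- exact: avoids_3124.
- exact: avoids_oplus1.
Qed.

End Backward.

(** * Reconstructing a permutation from its filling *)

Section Labels.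
Variables (n : nat) (w : filling n).

Definition content (i j : nat) : seq nat :=
  if [pick c : cell n | (crow c == i :> nat) && (ccol c == j :> nat)] is Some c
  then w c else [::].

Lemma contentE (c : cell n) : content (crow c) (ccol c) = w c.
Proof.
rewrite /content; case: pickP => [d /andP[/eqP rd /eqP cd]|/(_ c)].
  by congr (w _); exact: cell_eq.
by rewrite !eqxx.
Qed.

Lemma cell_ex i j : i <= j -> j < n -> exists c : cell n, crow c = i :> nat /\ ccol c = j :> nat.
Proof.
move=> ij jn; have i_n := leq_ltn_trans ij jn.
have c_in : inB (Ordinal i_n, Ordinal jn) by [].
by exists (exist (fun c => inB c) _ c_in).
Qed.

(* A label [(i, j, t)] stands for the left-to-right minimum number [i = j] if
   [t = 0], and otherwise for the [t]-th entry, counted from 1, of the cell in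
   row [i] and column [j]. *)
Definition label_ok (x : nat * nat * nat) :=
  [&& x.1.1 <= x.1.2, x.1.2 < n, (x.2 == 0) ==> (x.1.1 == x.1.2)
    & x.2 <= size (content x.1.1 x.1.2)].

(** Exceeds the size of every content, so it can serve as radix of the keys below. *)
Definition label_base := (\sum_(c : cell n) size (w c)).+1.

Lemma size_content i j : size (content i j) < label_base.
Proof.
rewrite /content ltnS; case: pickP => // c _.
by rewrite (bigD1 c) //= leq_addr.
Qed.

Definition labels : seq (nat * nat * nat) :=
  undup [seq x <- [seq (i, t) | i <- [seq (a, b) | a <- iota 0 n, b <- iota 0 n],
    t <- iota 0 label_base] | label_ok x].

Lemma mem_labels x : (x \in labels) = label_ok x.
Proof.
rewrite mem_undup mem_filter; case okx: (label_ok x); rewrite ?andTb //.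
case: x okx => [[i j] t] /and4P[ij jn _ tc].
apply: allpairs_f; first by apply: allpairs_f; rewrite mem_iota // (leq_ltn_trans ij).
by rewrite mem_iota (leq_ltn_trans tc (size_content _ _)).
Qed.

(** Lexicographic by column, then index: each column opens with its minimum, followed by the entries
    of its cell. *)
Definition poskey (x : nat * nat * nat) := x.1.2 * label_base + x.2.

Definition label_entry (x : nat * nat * nat) := nth 0 (content x.1.1 x.1.2) x.2.-1.

(** Lexicographic, with lower rows first, hence [n - x.1.1]; within a row the minimum, then the
    cells from left to right, then the values in a cell. *)
Definition valkey (x : nat * nat * nat) :=
  (n - x.1.1) * (n.+1 * label_base) +
  if x.2 == 0 then 0 else x.1.2.+1 * label_base + label_entry x.

Lemma lex_lt b a x a' x' : x < b -> x' < b ->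
  (a * b + x < a' * b + x') = (a < a') || (a == a') && (x < x').
Proof.
move=> xb x'b; have [aa'|a'a|->] /= := ltngtP a a'; last by rewrite ltn_add2l.
  have : a.+1 * b <= a' * b by rewrite leq_mul2r aa' orbT.
  by rewrite mulSn; lia.
have : a'.+1 * b <= a * b by rewrite leq_mul2r a'a orbT.
by rewrite mulSn; lia.
Qed.

Lemma poskey_lt x y : label_ok x -> label_ok y ->
  (poskey x < poskey y) = (x.1.2 < y.1.2) || (x.1.2 == y.1.2) && (x.2 < y.2).
Proof.
move=> /and4P[_ _ _ xt] /and4P[_ _ _ yt]; apply: lex_lt.
  exact: leq_ltn_trans xt (size_content _ _).
exact: leq_ltn_trans yt (size_content _ _).
Qed.

Hypothesis w_perm : forall c, is_perm (w c).

Lemma content_perm i j : is_perm (content i j).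
Proof. by rewrite /content; case: pickP. Qed.

Lemma label_entry_lt x : label_entry x < label_base.
Proof.
rewrite /label_entry; set t := content _ _.
have [lt|ge] := ltnP x.2.-1 (size t); last by rewrite nth_default.
by have /andP[_ /leq_ltn_trans] := is_perm_nth (content_perm _ _) lt; apply; exact: size_content.
Qed.

Lemma valkey_lt x y : label_ok x -> label_ok y ->
  (valkey x < valkey y) = (y.1.1 < x.1.1) || (x.1.1 == y.1.1) &&
    [|| (x.2 == 0) && (y.2 != 0)
      | [&& x.2 != 0, y.2 != 0 & (x.1.2 < y.1.2) ||
          (x.1.2 == y.1.2) && (label_entry x < label_entry y)]].
Proof.
move=> /and4P[xij xjn _ _] /and4P[yij yjn _ _].
have bnd z : z.1.2 < n ->
    (if z.2 == 0 then 0 else z.1.2.+1 * label_base + label_entry z) < n.+1 * label_base.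
  move=> zn; case: ifP => _; first by rewrite muln_gt0.
  rewrite -[ltnRHS]addn0; rewrite lex_lt ?label_entry_lt //; lia.
rewrite lex_lt ?bnd //; congr (_ || _); first by lia.
congr (_ && _); first by lia.
case: ifP => _; case: ifP => _ //=.
by rewrite lex_lt ?label_entry_lt // ltnS eqSS.
Qed.

Hypothesis w_col : forall c d, w c != [::] -> w d != [::] -> ccol c = ccol d -> c = d.

(** [poskey] forgets the row; it is recovered because a column has at most one non-empty cell. *)
Lemma col_row x y : label_ok x -> label_ok y -> x.2 != 0 -> y.2 != 0 ->
  x.1.2 = y.1.2 -> x.1.1 = y.1.1.
Proof.
move=> /and4P[xij xjn _ xt] /and4P[yij yjn _ yt] x0 y0 cxy.
have [c [rc cc]] := cell_ex xij xjn; have [d [rd cd]] := cell_ex yij yjn.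
rewrite -rc -rd; congr (nat_of_ord (crow _)); apply: w_col.
- by rewrite -contentE rc cc -size_eq0 -lt0n (leq_trans _ xt) // lt0n.
- by rewrite -contentE rd cd -size_eq0 -lt0n (leq_trans _ yt) // lt0n.
- by apply: val_inj; rewrite /= cc cd.
Qed.

Lemma poskey_inj x y : label_ok x -> label_ok y -> poskey x = poskey y -> x = y.
Proof.
move=> okx oky e.
have := poskey_lt okx oky; have := poskey_lt oky okx; rewrite e ltnn.
move=> h1 h2; have ec : x.1.2 = y.1.2 by lia.
have et : x.2 = y.2 by lia.
suff er : x.1.1 = y.1.1 by case: x y ec et er {okx oky e h1 h2} => [[? ?] ?] [[? ?] ?] /= -> -> ->.
have [x0|x0] := eqVneq x.2 0; last by apply: col_row => //; rewrite -et.
have [/and4P[_ _ hx _] /and4P[_ _ hy _]] := (okx, oky).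
move: hx hy; rewrite -et x0 /= => /eqP -> /eqP ->; exact: ec.
Qed.

Lemma valkey_inj x y : label_ok x -> label_ok y -> valkey x = valkey y -> x = y.
Proof.
move=> okx oky e.
have := valkey_lt okx oky; have := valkey_lt oky okx; rewrite e ltnn.
move=> h1 h2; have er : x.1.1 = y.1.1 by lia.
have [/and4P[_ _ hx tx] /and4P[_ _ hy ty]] := (okx, oky).
suff [ec et] : x.1.2 = y.1.2 /\ x.2 = y.2.
  by case: x y ec et er {okx oky e h1 h2 hx hy tx ty} => [[? ?] ?] [[? ?] ?] /= -> -> ->.
have [x0|x0] := eqVneq x.2 0.
  have y0 : y.2 = 0 by lia.
  by move: hx hy; rewrite x0 y0 /= => /eqP <- /eqP <-.
have y0 : y.2 != 0 by lia.
have ec : x.1.2 = y.1.2 by lia.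
split=> //; have ee : label_entry x = label_entry y by lia.
(* Contents have no repeated values, so equal entries sit at equal indices. *)
move/eqP: ee; rewrite /label_entry er ec nth_uniq ?(is_perm_uniq (content_perm _ _)) //.
- by lia.
- by rewrite -er -ec (leq_trans _ tx) // ltn_predL lt0n.
- by rewrite (leq_trans _ ty) // ltn_predL lt0n.
Qed.

(** Says that [s] is the permutation prescribed by the filling: its positions enumerate the labels
    in [poskey] order and its values follow [valkey]. *)
Record labelling (s : seq nat) (lab : nat -> nat * nat * nat) : Prop := Labelling {
  lab_pos : forall k l, k < l -> l < size s -> poskey (lab k) < poskey (lab l);
  lab_val : forall k l, k < size s -> l < size s ->
    (nth 0 s k < nth 0 s l) = (valkey (lab k) < valkey (lab l));
  lab_ok : forall k, k < size s -> label_ok (lab k);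
  lab_surj : forall x, label_ok x -> exists2 k, k < size s & lab k = x }.

Lemma sorted_lab s lab : labelling s lab ->
  sorted (relpre poskey ltn) [seq lab k | k <- iota 0 (size s)].
Proof.
move=> L; apply/(sortedP (0, 0, 0)) => i; rewrite size_map size_iota => si.
have si' := ltnW si; rewrite !(nth_map 0) ?size_iota // !nth_iota //=.
by apply: (lab_pos L) => //; rewrite ltnSn.
Qed.

Lemma poskey_trans : transitive (relpre poskey ltn).
Proof. by move=> x y z; apply: ltn_trans. Qed.

Lemma poskey_irr : irreflexive (relpre poskey ltn).
Proof. by move=> x; apply: ltnn. Qed.

Lemma labelling_filter s lab (Q : pred (nat * nat * nat)) M : labelling s lab ->
  sorted (relpre poskey ltn) M -> (forall x, (x \in M) = label_ok x && Q x) ->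
  [seq lab k | k <- iota 0 (size s) & Q (lab k)] = M.
Proof.
move=> L sM memM; rewrite -[LHS]filter_map.
apply: (irr_sorted_eq poskey_trans poskey_irr) => //.
  by apply: sorted_filter; [exact: poskey_trans|exact: sorted_lab].
move=> x; rewrite mem_filter memM andbC; congr (_ && _).
apply/mapP/idP => [[k]|okx].
  by rewrite mem_iota => /= ks ->; exact: (lab_ok L).
by have [k ks <-] := lab_surj L okx; exists k; rewrite // mem_iota.
Qed.

(** Both label sequences list all labels in [poskey] order, so they coincide, and [valkey] dictates
    the same relative order of values. *)
Lemma labelling_unique s s' lab lab' : is_perm s -> is_perm s' ->
  labelling s lab -> labelling s' lab' -> s = s'.
Proof.
move=> ps ps' L L'.
have eL : [seq lab k | k <- iota 0 (size s)] = [seq lab' k | k <- iota 0 (size s')].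
  rewrite -(labelling_filter (Q := predT) L (sorted_lab L')) ?filter_predT // => x.
  rewrite andbT; apply/mapP/idP => [[k]|okx].
    by rewrite mem_iota => /= ks ->; exact: (lab_ok L').
  by have [k ks <-] := lab_surj L' okx; exists k; rewrite // mem_iota.
have es : size s = size s' by have := congr1 size eL; rewrite !size_map !size_iota.
have el k : k < size s -> lab k = lab' k.
  move=> ks; have := congr1 (nth (0, 0, 0) ^~ k) eL.
  by rewrite !(nth_map 0) ?size_iota -?es // !nth_iota -?es.
apply: order_iso_perm_eq => //; split=> // k l ks ls.
by rewrite (lab_val L) // (lab_val L') -?es // !el.
Qed.

(** Sort the labels by [poskey], replace each by its [valkey], and standardize. *)
Lemma labelling_exists : exists s lab, is_perm s /\ labelling s lab.
Proof.
pose T := sort (relpre poskey leq) labels.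
have okT x : (x \in T) = label_ok x by rewrite mem_sort mem_labels.
have uT : uniq T by rewrite sort_uniq undup_uniq.
have sT : sorted ltn [seq poskey x | x <- T].
  rewrite ltn_sorted_uniq_leq map_inj_in_uniq ?uT ?sorted_map.
    by apply: sort_sorted => x y; apply: leq_total.
  by move=> x y; rewrite !okT; apply: poskey_inj.
pose V := [seq valkey x | x <- T].
have sV : size V = size T by rewrite size_map.
exists (standardize V), (nth (0, 0, 0) T); split.
  apply: is_perm_standardize; rewrite map_inj_in_uniq // => x y.
  by rewrite !okT; apply: valkey_inj.
have okn k : k < size T -> label_ok (nth (0, 0, 0) T k) by move=> kT; rewrite -okT mem_nth.
split; rewrite ?size_standardize ?sV //.
- move=> k l kl lT; have kT := ltn_trans kl lT.
  have : k < l < size [seq poskey x | x <- T] by rewrite size_map kl.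
  by move/(nth_ltn_sorted sT); rewrite !(nth_map (0, 0, 0)).
- by move=> k l kT lT; rewrite standardize_lt ?sV // !(nth_map (0, 0, 0)).
- by move=> x; rewrite -okT => /(nthP (0, 0, 0)).
Qed.

End Labels.

(** * Reading minima, cells and contents off a labelling *)

Section Decode.
Variables (n : nat) (w : filling n) (s : seq nat) (lab : nat -> nat * nat * nat).
Hypothesis w_perm : forall c, is_perm (w c).
Hypothesis us : uniq s.
Hypothesis L : labelling w s lab.

Lemma label_ok_diag j : j < n -> label_ok w (j, j, 0).
Proof. by move=> jn; rewrite /label_ok /= leqnn jn eqxx. Qed.

Lemma lab_pos_lt k l : k < size s -> l < size s ->
  (k < l) = (poskey w (lab k) < poskey w (lab l)).
Proof.
move=> ks ls; have [kl|lk|->] := ltngtP k l; last by rewrite ltnn.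
  by rewrite (lab_pos L).
by apply/esym/negbTE; rewrite -leqNgt ltnW // (lab_pos L).
Qed.

(** A label of positive index comes after the minimum of its row and has a larger value. Before a
    minimum there are only smaller columns, hence higher rows and larger values. *)
Lemma is_lrmin_lab k : k < size s -> is_lrmin s k = ((lab k).2 == 0).
Proof.
move=> ks; have okk := lab_ok L ks.
have [kij kjn kd kt] := and4P okk.
apply/is_lrminP/idP => [kmin|k0 j jk].
  apply/negPn/negP => k0.
  have okp := label_ok_diag (leq_ltn_trans kij kjn).
  have [p ps ep] := lab_surj L okp.
  have pk : p < k.
    by rewrite lab_pos_lt // ep poskey_lt //= lt0n k0 andbT orbC -leq_eqVlt.
  have := kmin p pk; rewrite ltnNge ltnW // (lab_val L) // ep valkey_lt //=.
  by rewrite eqxx k0 orbT.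
have js := ltn_trans jk ks; have okj := lab_ok L js; have [jij _ _ _] := and4P okj.
rewrite (lab_val L) // valkey_lt //; apply/orP; left.
move: jk; rewrite lab_pos_lt // poskey_lt // (eqP k0) ltn0 andbF orbF => ck.
by rewrite k0 /= in kd; rewrite (eqP kd); apply: leq_ltn_trans ck.
Qed.

Lemma lab_lrmin_pos : [seq lab k | k <- lrmin_pos s] = [seq (j, j, 0) | j <- iota 0 n].
Proof.
have -> : lrmin_pos s = [seq k <- iota 0 (size s) | (lab k).2 == 0].
  by apply: eq_in_filter => k; rewrite mem_iota => /= ks; exact: is_lrmin_lab.
apply: (labelling_filter (Q := fun x => x.2 == 0) L).
  rewrite sorted_map; apply: sub_sorted (iota_ltn_sorted 0 n) => i j ij /=.
  by rewrite /poskey /= !addn0 ltn_pmul2r.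
move=> [[i j] t]; apply/mapP/idP => [[k]|].
  by rewrite mem_iota => /= kn [-> -> ->]; rewrite label_ok_diag.
case/andP=> /and4P[/= ij jn + _] /eqP t0; rewrite t0 eqxx => /= /eqP->.
by exists j; rewrite // mem_iota.
Qed.

Lemma size_lrmin_pos_lab : size (lrmin_pos s) = n.
Proof. by have := congr1 size lab_lrmin_pos; rewrite !size_map size_iota. Qed.

Lemma lab_nth_lrmin_pos j : j < n -> lab (nth 0 (lrmin_pos s) j) = (j, j, 0).
Proof.
move=> jn; have := congr1 (nth (0, 0, 0) ^~ j) lab_lrmin_pos.
by rewrite !(nth_map 0) ?size_iota ?size_lrmin_pos_lab // nth_iota.
Qed.

Lemma nonmin_lab k : nonmin s k -> (lab k).2 != 0.
Proof. by case/andP=> ks; rewrite is_lrmin_lab. Qed.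

Lemma entry_col_lab k : nonmin s k -> entry_col s k = (lab k).1.2.
Proof.
move=> km; have [ks _] := andP km; have okk := lab_ok L ks; have [_ kn _ _] := and4P okk.
(* Both numbers pass the same threshold tests, and each is itself a threshold below [n]. *)
have key j : j < n -> (j <= entry_col s k) = (j <= (lab k).1.2).
  move=> jn; have jN : j < size (lrmin_pos s) by rewrite size_lrmin_pos_lab.
  have [ps _] := nth_lrmin_pos jN.
  rewrite -lrmin_pos_lt // lab_pos_lt // lab_nth_lrmin_pos // poskey_lt ?label_ok_diag //=.
  by rewrite lt0n (nonmin_lab km) andbT orbC -leq_eqVlt.
have cn : entry_col s k < n by rewrite -size_lrmin_pos_lab entry_col_lt.
by apply/eqP; rewrite eqn_leq -key // leqnn key // leqnn.
Qed.

Lemma entry_row_lab k : nonmin s k -> entry_row s k = (lab k).1.1.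
Proof.
move=> km; have [ks _] := andP km; have okk := lab_ok L ks; have [kij kn _ _] := and4P okk.
have key j : j < n -> (entry_row s k <= j) = ((lab k).1.1 <= j).
  move=> jn; have jN : j < size (lrmin_pos s) by rewrite size_lrmin_pos_lab.
  have [ps _] := nth_lrmin_pos jN.
  rewrite -lrmin_val_lt // nth_lrmin_val // (lab_val L) // lab_nth_lrmin_pos //.
  rewrite valkey_lt ?label_ok_diag //= (nonmin_lab km) orbF andbT orbC eq_sym.
  by rewrite -leq_eqVlt.
have rn : entry_row s k < n by rewrite -size_lrmin_pos_lab entry_row_lt.
have rn' := leq_ltn_trans kij kn.
by apply/eqP; rewrite eqn_leq key // leqnn -key // leqnn.
Qed.

Lemma lab_row_increasing : row_increasing s.
Proof.
move=> k l km lm; rewrite !entry_row_lab // !entry_col_lab // => rkl ckl.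
have [ks _] := andP km; have [ls _] := andP lm.
rewrite (lab_val L) // valkey_lt ?(lab_ok L) // rkl eqxx ckl.
by rewrite (nonmin_lab km) (nonmin_lab lm) /= !orbT.
Qed.

Lemma SE_lab : SE n s = w.
Proof.
apply/ffunP => c; rewrite ffunE cell_entriesE; set ks := cell_pos _ _ _.
pose M := [seq (crow c : nat, ccol c : nat, t.+1) | t <- iota 0 (size (w c))].
have crc : crow c <= ccol c by have := valP c.
have okM t : t < size (w c) -> label_ok w (crow c : nat, ccol c : nat, t.+1).
  by move=> tc; rewrite /label_ok /= contentE crc ltn_ord.
(* The positions of the cell carry exactly its labels, in order; [valkey] compares these by the
   entries of the content. *)
have labks : [seq lab k | k <- ks] = M.
  pose Q (x : nat * nat * nat) := [&& x.2 != 0, x.1.1 == crow c & x.1.2 == ccol c].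
  have -> : ks = [seq k <- iota 0 (size s) | Q (lab k)].
    apply: eq_in_filter => k; rewrite mem_iota /Q => /= lks.
    rewrite -is_lrmin_lab //; case km: (is_lrmin s k) => //=.
    have nk : nonmin s k by rewrite /nonmin lks km.
    by rewrite entry_row_lab // entry_col_lab.
  apply: (labelling_filter (Q := Q) L).
    rewrite sorted_map; apply: sub_sorted (iota_ltn_sorted 0 _) => i j ij /=.
    by rewrite /poskey /= ltn_add2l.
  move=> [[i j] t]; apply/mapP/idP => [[t']|].
    by rewrite mem_iota => /= tn [-> -> ->]; rewrite okM //= /Q /= !eqxx.
  case/andP=> /and4P[/= ij jn _ tc] /and3P[/= t0 /eqP ei /eqP ej].
  exists t.-1; last by rewrite prednK ?lt0n // ei ej.
  by rewrite ei ej contentE in tc; rewrite mem_iota /= add0n prednK ?lt0n.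
have sks : size ks = size (w c).
  by have := congr1 size labks; rewrite !size_map size_iota.
have labn t : t < size (w c) -> lab (nth 0 ks t) = (crow c : nat, ccol c : nat, t.+1).
  move=> tc; have := congr1 (nth (0, 0, 0) ^~ t) labks.
  by rewrite !(nth_map 0) ?size_iota ?sks // nth_iota.
have ksn t : t < size (w c) -> nth 0 ks t < size s.
  rewrite -sks => /(mem_nth 0); rewrite mem_cell_pos => /andP[/andP[]] //.
rewrite -[RHS]standardize_id //; apply: order_iso_standardize.
split; rewrite size_map sks // => a b ac bc.
rewrite !(nth_map 0) ?sks // (lab_val L) ?ksn // !labn // valkey_lt ?okM //=.
by rewrite /label_entry /= !contentE !eqxx !ltnn.
Qed.

End Decode.

(** * Labelling a given permutation by its minima and cells *)

Definition label_of (s : seq nat) (k : nat) : nat * nat * nat :=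
  if is_lrmin s k then (index k (lrmin_pos s), index k (lrmin_pos s), 0)
  else (entry_row s k, entry_col s k,
        (index k (cell_pos s (entry_row s k) (entry_col s k))).+1).

Section Encode.
Variables (n : nat) (s : seq nat).
Hypothesis us : uniq s.
Hypothesis sn : size (lrmin_pos s) = n.
Hypothesis free : UDC_free s.
Hypothesis incr : row_increasing s.

Let w := SE n s.

Lemma content_SE i j : i <= j -> j < n ->
  content w i j = standardize [seq nth 0 s k | k <- cell_pos s i j].
Proof.
move=> ij jn; have [c [rc cc]] := cell_ex ij jn.
by rewrite -rc -cc contentE ffunE cell_entriesE.
Qed.

Lemma SE_perm c : is_perm (w c). Proof. exact: SE_is_perm. Qed.

Lemma lrmin_or_nonmin k : k < size s ->
  (exists2 j, j < n & k = nth 0 (lrmin_pos s) j /\ label_of s k = (j, j, 0)) \/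
  nonmin s k /\ label_of s k = (entry_row s k, entry_col s k,
    (index k (cell_pos s (entry_row s k) (entry_col s k))).+1).
Proof.
move=> ks; rewrite /label_of /nonmin ks; case: ifP => [km|_]; [left|by right].
have kp : k \in lrmin_pos s by rewrite mem_lrmin_pos ks.
by exists (index k (lrmin_pos s)); rewrite -?sn ?index_mem // nth_index.
Qed.

Lemma mem_own_cell k : nonmin s k -> k \in cell_pos s (entry_row s k) (entry_col s k).
Proof. by move=> km; rewrite mem_cell_pos km !eqxx. Qed.

Lemma label_of_ok k : k < size s -> label_ok w (label_of s k).
Proof.
move=> /lrmin_or_nonmin[[j jn [_ ->]]|[km ->]]; first exact: label_ok_diag.
have rc := entry_row_col us km; have cn := entry_col_lt us km; rewrite sn in cn.
rewrite /label_ok /= rc cn content_SE // size_standardize size_map index_mem.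
exact: mem_own_cell.
Qed.

Lemma label_of_pos k l : k < l -> l < size s ->
  poskey w (label_of s k) < poskey w (label_of s l).
Proof.
move=> kl ls; have ks := ltn_trans kl ls.
rewrite poskey_lt ?label_of_ok //.
case: (lrmin_or_nonmin ks) => [[i i_n [ek ->]]|[km ->]];
case: (lrmin_or_nonmin ls) => [[j j_n [el ->]]|[lm ->]] /=.
- by move: kl; rewrite ek el ltn_lrmin_pos ?sn // => ->.
- move: kl; rewrite ek lrmin_pos_lt ?sn // leq_eqVlt orbC andbT.
  by case/orP => ->; rewrite ?orbT.
- by move: kl; rewrite el lt_lrmin_pos ?sn // => ->.
(* Two entries of one column share a cell and are ordered by their index in it. *)
- have := entry_col_mono us km lm (ltnW kl); rewrite leq_eqVlt => /orP[/eqP ckl|->//].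
  have [_ _ /(_ ckl) rkl] := free km lm.
  have lc := mem_own_cell lm; rewrite -rkl -ckl in lc *.
  by rewrite ltnS index_ltn_sorted ?sorted_cell_pos ?mem_own_cell // kl eqxx orbT.
Qed.

Lemma label_of_val_homo k l : k < size s -> l < size s -> nth 0 s k < nth 0 s l ->
  valkey w (label_of s k) < valkey w (label_of s l).
Proof.
move=> ks ls skl; rewrite valkey_lt ?label_of_ok //; last exact: SE_perm.
case: (lrmin_or_nonmin ks) => [[i i_n [ek ->]]|[km ->]];
case: (lrmin_or_nonmin ls) => [[j j_n [el ->]]|[lm ->]] /=.
- by move: skl; rewrite ek el -!nth_lrmin_val ?sn // ltn_lrmin_val ?sn // => ->.
- by move: skl; rewrite ek -nth_lrmin_val ?sn // lrmin_val_lt ?sn // leq_eqVlt eq_sym andbT orbC.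
- by move: skl; rewrite el -nth_lrmin_val ?sn // lt_lrmin_val ?sn // => ->.
(* In one row, a larger value in an earlier column contradicts increasing rows; in one cell,
   standardizing keeps the order. *)
- have := entry_row_mono us km (ltnW skl); rewrite leq_eqVlt => /orP[/eqP rkl|->//].
  rewrite rkl eqxx ltnn /=.
  have [ckl|clk|ckl] := ltngtP (entry_col s k) (entry_col s l) => //=.
    by have := incr lm km rkl clk; rewrite ltnNge (ltnW skl).
  rewrite /label_entry /=.
  have rc := entry_row_col us km; have cn := entry_col_lt us km; rewrite sn in cn.
  have kc := mem_own_cell km; have lc := mem_own_cell lm.
  rewrite rkl -ckl in lc *.
  rewrite content_SE // standardize_lt ?size_map ?index_mem //.
  by rewrite !(nth_map 0) ?index_mem // !nth_index.
Qed.

Lemma labelling_label_of : labelling w s (label_of s).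
Proof.
split=> [|k l ks ls||[[i j] t] okx].
- exact: label_of_pos.
- have [kl|kl] := eqVneq k l; first by rewrite kl !ltnn.
  apply/idP/idP => [|h]; first exact: label_of_val_homo.
  rewrite nth_uniq_lt //; apply/negP => /(label_of_val_homo ls ks).
  by rewrite ltnNge ltnW.
- exact: label_of_ok.
case/and4P: okx => /= ij jn; case: t => [|t] /=.
  move=> /eqP-> _; have jN : j < size (lrmin_pos s) by rewrite sn.
  have [ps pm] := nth_lrmin_pos jN; exists (nth 0 (lrmin_pos s) j) => //.
  by rewrite /label_of pm index_uniq ?(sorted_uniq ltn_trans ltnn (sorted_lrmin_pos s)).
move=> _; rewrite content_SE // size_standardize size_map => tc.
have := mem_nth 0 tc; rewrite mem_cell_pos => /and3P[km /eqP rk /eqP ck].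
exists (nth 0 (cell_pos s i j) t); first by case/andP: km.
rewrite /label_of rk ck; case/andP: km => _ /negbTE->.
by rewrite index_uniq ?(sorted_uniq ltn_trans ltnn (sorted_cell_pos s i j)).
Qed.

End Encode.

Theorem theorem7p3 (P : set (seq nat))
    (P_perm : forall p, P p -> is_perm p /\ p <> [::])
    (P_indec : forall p, (bar @` P) p -> sum_indecomposable p)
    (n : nat) :
  set_bij
    (Avn n ([set [:: 2; 4; 1; 3]; [:: 3; 1; 4; 2]; [:: 3; 1; 2; 4]]
            `|` (oplus [:: 1] @` P)))
    (WI (@rho n) (@UDC n)
       (Avp ([set [:: 3; 1; 2]] `|` (bar @` P)))
       (Avp ([set [:: 2; 4; 1; 3]; [:: 3; 1; 4; 2]; [:: 3; 1; 2; 4]] `|` P)))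
    (@SE n).
Proof.
split.
- by move=> s [sAv sn]; apply: SE_mapsto_WI.
- move=> s s' /set_mem[sAv sn] /set_mem[s'Av s'n] eSE.
  have [ps ps'] := (sAv.1, s'Av.1).
  (* Injectivity: both permutations are labelled by the same filling. *)
  have L := labelling_label_of (is_perm_uniq ps) sn (Av_UDC_free sAv) (Av_row_increasing sAv).
  have L' := labelling_label_of (is_perm_uniq ps') s'n (Av_UDC_free s'Av) (Av_row_increasing s'Av).
  by rewrite -eSE in L'; apply: labelling_unique L L'.
- move=> w wWI; have [ind cont] := wWI.
  (* Both classes consist of permutations, and an empty cell holds the empty one. *)
  have w_perm c : is_perm (w c).
    have [->//|ne] := eqVneq (w c) [::].
    have cN : c \in nonempty_cells w by rewrite inE.
    by have := cont c cN; case: (rho _ _) => -[[]].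
  (* Distinct cells of one column are adjacent, so independence leaves at most one of them
     non-empty. *)
  have w_col c d : w c != [::] -> w d != [::] -> ccol c = ccol d -> c = d.
    move=> cne dne cd; apply/eqP; have := ind c d; rewrite !inE cne dne => /(_ isT isT).
    by rewrite /UDC cd eqxx !orbT andbT negbK.
  have [s [lab [ps L]]] := labelling_exists w_perm w_col.
  have us := is_perm_uniq ps.
  have sn := size_lrmin_pos_lab w_perm L.
  have eSE := SE_lab w_perm us L; exists s => //; split=> //.
  rewrite -eSE in wWI.
  exact: (WI_Av P_perm P_indec sn us (lab_row_increasing w_perm us L) wWI).
Qed.
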